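(* The mapping $\Psi:\mathcal{SD}_{NS}^{+}\to \mathrm{End}(W)$, defined in terms of generating functions (by equating coefficients of monomials in $y_1,y_2,x$) by $$\mathcal{D}^{y_1,y_2}(x)\ \longmapsto\ :\!X(e^{y_1}x)X(e^{y_2}x)\!:,$$ $$\bar{\mathcal{D}}^{y_1,y_2}(x)\ \longmapsto\ :\!\tilde X(e^{y_1}x)\tilde X(e^{y_2}x)\!:,$$ $$G^{y_1,y_2}(x)\ \longmapsto\ \tilde X(e^{y_1}x)X(e^{y_2}x),$$ defines a projective representation of the Lie superalgebra $\mathcal{SD}_{NS}^{+}$ on $W$. Here $\mathcal{D}^{y_1,y_2}(x)$ and $\bar{\mathcal{D}}^{y_1,y_2}(x)$ are regarded as generating functions of even elements of $\mathcal{SD}_{NS}^{+}$ via the embeddings $\iota_1$ and $\iota_2$, respectively.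
   Context: All vector spaces are over $\mathbb{C}$; $x,y_1,y_2$ are commuting formal variables; $D=t\frac{d}{dt}$. A projective representation is a representation up to central (scalar) terms in the commutators. **Differential operators.** $\mathcal{D}$ is the algebra (and Lie algebra) spanned by $t^kD^l$, $k\in\mathbb{Z}$, $l\ge 0$. $\mathrm{Diff}[t,t^{-1},\theta]$ is the associative superalgebra of operators on $\mathbb{C}[t,t^{-1},\theta]$ ($\theta$ odd, $\theta^2=0$, $\theta$ commuting with $t$) given by $\mathcal{D}\otimes C(1)$, where $C(1)$ is generated by the odd elements $\theta,\frac{\partial}{\partial\theta}$ with $\theta\frac{\partial}{\partial\theta}+\frac{\partial}{\partial\theta}\theta=1$, $\theta^2=(\frac{\partial}{\partial\theta})^2=0$; elements of $\mathcal{D}$ are even and commute with $C(1)$. The Lie superbracket is $[a,b]=ab-(-1)^{p(a)p(b)}ba$. The embeddings are $\iota_1(A)=A\frac{\partial}{\partial\theta}\theta$ and $\iota_2(A)=A\,\theta\frac{\partial}{\partial\theta}$. $\mathcal{SD}_{NS}=\mathcal{SD}_{NS,0}\oplus\mathcal{SD}_{NS,1}$, where the even part $\mathcal{SD}_{NS,0}$ is spanned by $t^kD^lD\frac{\partial}{\partial\theta}\theta$ and $t^kD^l\theta\frac{\partial}{\partial\theta}$ ($k\in\mathbb{Z}$, $l\ge0$), and the odd part $\mathcal{SD}_{NS,1}$ is spanned by $t^kD^lD\theta$ and $t^kD^l\frac{\partial}{\partial\theta}$ ($k\in\mathbb{Z}+\frac12$, $l\ge 0$). The involution $\gamma$ of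 $\mathcal{SD}_{NS}$ is, for polynomials $P$, $$\gamma(t^kP(D)D\tfrac{\partial}{\partial\theta}\theta)=t^kP(-D-k)D\tfrac{\partial}{\partial\theta}\theta,\quad \gamma(t^kP(D)\theta\tfrac{\partial}{\partial\theta})=-t^kP(-D-k)\theta\tfrac{\partial}{\partial\theta},$$ $$\gamma(t^kP(D)D\theta)=t^kP(-D-k)\tfrac{\partial}{\partial\theta},\quad \gamma(t^kP(D)\tfrac{\partial}{\partial\theta})=t^kP(-D-k)D\theta .$$ $\mathcal{SD}_{NS}^{+}$ is the Lie superalgebra of $\gamma$-fixed elements. **Generating functions.** Let $\delta(x)=\sum_{n\in\mathbb{Z}}x^n$, $\delta_{1/2}(x)=x^{1/2}\delta(x)$, and $$\mathcal{D}^{y_1,y_2}(x)=e^{-y_1D}\delta(\tfrac tx)e^{y_2D}D+e^{-y_2D}\delta(\tfrac tx)e^{y_1D}D,$$ $$\bar{\mathcal{D}}^{y_1,y_2}(x)=e^{-y_1D}\delta(\tfrac tx)e^{y_2D}-e^{-y_2D}\delta(\tfrac tx)e^{y_1D},$$ $$G^{y_1,y_2}(x)=e^{-y_1D}\delta_{1/2}(\tfrac tx)e^{y_2D}\theta D+e^{-y_2D}\delta_{1/2}(\tfrac tx)e^{y_1D}\tfrac{\partial}{\partial\theta}.$$ The coefficients of $\iota_1(\mathcal{D}^{y_1,y_2}(x))$, $\iota_2(\bar{\mathcal{D}}^{y_1,y_2}(x))$ and $G^{y_1,y_2}(x)$ span $\mathcal{SD}_{NS}^{+}$. **The space $W$.**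 $W=M(1)\otimes F$. Here $M(1)=\mathbb{C}[h(-1),h(-2),\dots]$ is the vacuum module for the Heisenberg algebra $[h(m),h(n)]=m\delta_{m+n,0}$ ($h(n)$, $n>0$, kills the vacuum; $h(0)=0$), and $F=\bigwedge(\varphi(-1/2),\varphi(-3/2),\dots)$ is the Fock module for the odd operators $\varphi(n)$, $n\in\mathbb{Z}+\frac12$, with $\varphi(m)\varphi(n)+\varphi(n)\varphi(m)=\delta_{m+n,0}$ ($\varphi(n)$, $n>0$, kills the vacuum). The $h(n)$ commute with the $\varphi(m)$. $W$ is a vertex operator superalgebra, with vacuum $\mathbf 1$ and vertex operators $Y(\cdot,x)$, and $$X(x)=Y(x^{L(0)}h(-1)\mathbf 1,x)=\sum_{n\in\mathbb{Z}}h(n)x^{-n},\qquad \tilde X(x)=Y(x^{L(0)}\varphi(-1/2)\mathbf 1,x)=\sum_{n\in\mathbb{Z}+1/2}\varphi(n)x^{-n}.$$ Normal ordering: $:\!h(m)h(n)\!:$ equals $h(m)h(n)$ if $m\le n$ and $h(n)h(m)$ if $m>n$; $:\!\varphi(m)\varphi(n)\!:$ equals $\varphi(m)\varphi(n)$ if $m\le n$ and $-\varphi(n)\varphi(m)$ if $m>n$.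
   Formalization: X(x) is replaced by iX(x), so the bosonic series maps to −:X(e^{y1}x)X(e^{y2}x): and G to i·X̃(e^{y1}x)X(e^{y2}x); as stated, t^nD ↦ L(n) gives [t^mD,t^nD]=(n−m)t^{m+n}D against [L(m),L(n)]=(m−n)L(m+n)+scalar, so brackets fail. *)

(* Defs.v *)
From HB Require Import structures.
From mathcomp Require Import all_boot all_order all_algebra.
From mathcomp Require Import finmap monalg ring zify.
From mathcomp Require Import complex reals.
Set Implicit Arguments. Unset Strict Implicit. Unset Printing Implicit Defensive.
Import Order.TTheory GRing.Theory Num.Theory.
Local Open Scope ring_scope.

Section LinearExtension.
Context {K : numFieldType} {B : choiceType} {V : lmodType K}.

Definition linext (f : B -> V) (a : {malg K[B]}) : V :=
  \sum_(k <- msupp a) a@_k *: f k.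

Lemma linextEw (d : {fset B}) f a : (msupp a `<=` d)%fset ->
  linext f a = \sum_(k <- d) a@_k *: f k.
Proof.
move=> le; rewrite [LHS](big_fset_incl _ le) => //= x xd /mcoeff_outdom ->.
by rewrite scale0r.
Qed.

Lemma linext_is_linear f : linear (linext f).
Proof.
move=> c a b; pose d := (msupp a `|` msupp b `|` msupp (c *: a + b))%fset.
have s1 : (msupp a `<=` d)%fset by rewrite /d -fsetUA fsubsetUl.
have s2 : (msupp b `<=` d)%fset by rewrite /d fsetUAC fsubsetUr.
rewrite (linextEw _ s1) (linextEw _ s2) (@linextEw d) ?fsubsetUr//.
rewrite scaler_sumr -big_split /=; apply: eq_bigr => k _.
by rewrite mcoeffD mcoeffZ scalerDl scalerA.
Qed.

HB.instance Definition _ f :=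
  GRing.isLinear.Build K {malg K[B]} V *:%R (linext f) (linext_is_linear f).

Lemma linextU f k : linext f << k >> = f k.
Proof. by rewrite (linextEw _ msuppU_le) big_seq_fset1 mcoeffUU scale1r. Qed.

Lemma linextDf f g a : linext (fun k => f k + g k) a = linext f a + linext g a.
Proof. by rewrite /linext -big_split; apply: eq_bigr=> k _; rewrite scalerDr. Qed.

Lemma linextZf c f a : linext (fun k => c *: f k) a = c *: linext f a.
Proof.
rewrite /linext scaler_sumr; apply: eq_bigr=> k _.
by rewrite !scalerA mulrC.
Qed.
End LinearExtension.

Lemma malg_linear_eq (K : numFieldType) (B : choiceType) (V : lmodType K)
  (f g : {linear {malg K[B]} -> V}) (a : {malg K[B]}) :
  (forall k, k \in msupp a -> f << k >> = g << k >>) -> f a = g a.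
Proof.
move=> H; rewrite [a]monalgE !raddf_sum /=; rewrite [LHS]big_seq [RHS]big_seq.
apply: eq_bigr => k ka.
have -> : << a@_k *g k >> = a@_k *: << k >>.
  by apply/malgP => k'; rewrite mcoeffZ !mcoeffU mulrnAr mulr1.
by rewrite !linearZ /= H.
Qed.

Section DiffOp.
Context (K : numFieldType).

(* The index (e, l, (r, s)) stands for t^(e/2) D^l E_(r,s), where
     E_(false,false) = d/dtheta theta,   E_(true,true)  = theta d/dtheta,
     E_(true,false)  = theta,            E_(false,true) = d/dtheta;
   these four elements form a basis of C(1) and multiply as 2 x 2 matrix
   units.  Exponents of t are stored doubled, to allow t^(1/2). *)
Definition doidx : choiceType := (int * nat * (bool * bool))%type.
Definition diffop := {malg K[doidx]}.
HB.instance Definition _ := GRing.Lmodule.on diffop.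

Definition mono (e : int) (l : nat) (c : bool * bool) : diffop := << ((e, l, c) : doidx) >>.

(* t^(e/2) P(D) E_c *)
Definition tD (e : int) (c : bool * bool) (P : {poly K}) : diffop :=
  \sum_(l < size P) P`_l *: mono e l c.

Lemma tDE e P c k :
  (tD e c P)@_k = P`_k.1.2 *+ ((e == k.1.1) && (c == k.2)).
Proof.
case: k => [[e' l'] c']; rewrite /tD /= raddf_sum /=.
pose E := (e == e') && (c == c').
have EE (i : 'I_(size P)) : (P`_i *: mono e i c)@_(e', l', c') =
    P`_i *+ (E && (i == l' :> nat)).
  by rewrite mcoeffZ mcoeffU !xpair_eqE andbAC mulrnAr mulr1.
rewrite (eq_bigr _ (fun i _ => EE i)) -/E; case: E {EE}; last first.
  by rewrite mulr0n big1.
rewrite mulr1n /=; case: (ltnP l' (size P)) => h.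
  rewrite (bigD1 (Ordinal h)) //= eqxx mulr1n big1 ?addr0 // => i ne.
  by rewrite -val_eqE /= in ne; rewrite (negbTE ne).
rewrite nth_default // big1 // => i _.
by rewrite (_ : (i == l' :> nat) = false) //; apply: ltn_eqF (leq_trans _ h).
Qed.

Lemma tD_linear e c : linear (tD e c).
Proof.
move=> x P Q; apply/malgP => k.
by rewrite mcoeffD mcoeffZ !tDE coefD coefZ mulrnDl mulrnAr.
Qed.
HB.instance Definition _ e c :=
  GRing.isLinear.Build K {poly K} diffop *:%R (tD e c) (tD_linear e c).

Lemma tDZ e c x P : tD e c (x *: P) = x *: tD e c P.
Proof. exact: linearZZ. Qed.

Lemma tDXn e l c : tD e c 'X^l = mono e l c.
Proof.
apply/malgP => -[[e' l'] c']; rewrite tDE /= coefXn mcoeffU !xpair_eqE [l' == l]eq_sym.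
by case: (e == e') (l == l') (c == c') => [] [] [].
Qed.

Definition sh (e : int) : {poly K} := 'X + (e%:~R / 2%:R)%:P.

(* P(D) t^(f/2) = t^(f/2) P(D + f/2) *)
Definition bmul (i j : doidx) : diffop :=
  let: (e, l, (r, s)) := i in let: (f, m, (r', s')) := j in
  if s == r' then tD (e + f) (r, s') (sh f ^+ l * 'X^m) else 0.

Definition dmul (a b : diffop) : diffop := linext (fun i => linext (bmul i) b) a.

Lemma dmulDl : left_distributive dmul +%R.
Proof. by move=> a b c; rewrite /dmul linearD. Qed.
Lemma dmulDr : right_distributive dmul +%R.
Proof.
move=> a b c; rewrite /dmul -linextDf /linext; apply: eq_bigr => i _.
by congr (_ *: _); exact: (linearD (linext _)).
Qed.
Lemma dmulZl x a b : dmul (x *: a) b = x *: dmul a b.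
Proof. by rewrite /dmul linearZ. Qed.
Lemma dmulZr x a b : dmul a (x *: b) = x *: dmul a b.
Proof.
rewrite /dmul -linextZf /linext; apply: eq_bigr => i _.
by congr (_ *: _); exact: (linearZZ (linext _)).
Qed.
Lemma dmul0r a : dmul a 0 = 0.
Proof. by have := dmulZr 0 a 0; rewrite !scale0r. Qed.
Lemma dmul0l a : dmul 0 a = 0.
Proof. by have := dmulZl 0 0 a; rewrite !scale0r. Qed.

Lemma dmul_suml (I : Type) (r : seq I) (F : I -> diffop) b :
  dmul (\sum_(i <- r) F i) b = \sum_(i <- r) dmul (F i) b.
Proof. by elim/big_rec2: _ => [|i x y _ <-]; rewrite ?dmul0l ?dmulDl. Qed.
Lemma dmul_sumr (I : Type) (r : seq I) (F : I -> diffop) b :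
  dmul b (\sum_(i <- r) F i) = \sum_(i <- r) dmul b (F i).
Proof. by elim/big_rec2: _ => [|i x y _ <-]; rewrite ?dmul0r ?dmulDr. Qed.

Lemma tDM e P f Q c d : dmul (tD e c P) (tD f d Q) =
  if c.2 == d.1 then tD (e + f) (c.1, d.2) ((P \Po sh f) * Q) else 0.
Proof.
case: c d => r s [r' s'] /=.
rewrite {1 2}/tD dmul_suml.
under eq_bigr do rewrite dmul_sumr.
under eq_bigr do under eq_bigr do rewrite dmulZl dmulZr /dmul /mono !linextU /=.
have [_|_] := eqP; last by rewrite big1 // => i _; rewrite big1 // => j _; rewrite !scaler0.
rewrite comp_polyE mulr_suml (linear_sum (tD (e + f) (r, s'))) /=.
apply: eq_bigr => i _; rewrite -scalerAl tDZ /=.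
rewrite -scaler_sumr; congr (_ *: _).
rewrite -[in RHS](coefK Q) poly_def mulr_sumr (linear_sum (tD (e + f) (r, s'))) /=.
by apply: eq_bigr => j _; rewrite -scalerAr tDZ.
Qed.

Lemma do_ind (f g : diffop -> diffop) : linear f -> linear g ->
  (forall e P c, f (tD e c P) = g (tD e c P)) -> f =1 g.
Proof.
move=> lf lg H a.
pose F := GRing.isLinear.Build K diffop diffop *:%R f lf.
pose G := GRing.isLinear.Build K diffop diffop *:%R g lg.
pose f' : {linear {malg K[doidx]} -> diffop} := HB.pack f F.
pose g' : {linear {malg K[doidx]} -> diffop} := HB.pack g G.
apply: (@malg_linear_eq _ _ _ f' g') => -[[e l] c] _.
by rewrite -[<< _ >>]/(mono e l c) -tDXn; apply: H.
Qed.

Lemma sh_comp e f : sh e \Po sh f = sh (e + f).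
Proof.
rewrite /sh comp_polyD comp_polyX comp_polyC -addrA -polyCD.
by congr (_ + _%:P); rewrite intrD mulrDl addrC.
Qed.

Lemma dmulA : associative dmul.
Proof.
move=> a b c.
have l1 x y : linear (fun a => dmul a (dmul x y)).
  by move=> z u v; rewrite dmulDl dmulZl.
have l2 x y : linear (fun a => dmul (dmul a x) y).
  by move=> z u v; rewrite !dmulDl !dmulZl.
apply: (do_ind (l1 b c) (l2 b c)) => e P cc.
have l3 x y : linear (fun b => dmul x (dmul b y)).
  by move=> z u v; rewrite ?(dmulDl, dmulZl, dmulDr, dmulZr).
have l4 x y : linear (fun b => dmul (dmul x b) y).
  by move=> z u v; rewrite ?(dmulDl, dmulZl, dmulDr, dmulZr).
apply: (do_ind (l3 _ c) (l4 _ c)) => f Q cd.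
have l5 x y : linear (fun c => dmul x (dmul y c)).
  by move=> z u v; rewrite ?(dmulDl, dmulZl, dmulDr, dmulZr).
have l6 x y : linear (fun c => dmul (dmul x y) c).
  by move=> z u v; rewrite ?(dmulDl, dmulZl, dmulDr, dmulZr).
apply: (do_ind (l5 _ _) (l6 _ _)) => g R ce {a b c}.
rewrite !tDM; case: ifP => h1; case: ifP => h2; rewrite ?dmul0l ?dmul0r ?tDM /= ?h1 ?h2 //.
by rewrite comp_polyM -comp_polyA sh_comp addrA mulrA.
Qed.

(* the element t^(e/2) P(D) of D (x) 1 *)
Definition dop e P : diffop := tD e (false, false) P + tD e (true, true) P.

Lemma sh0 : sh 0 = 'X.
Proof. by rewrite /sh mul0r addr0. Qed.

Lemma dmul1l : left_id (dop 0 1) dmul.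
Proof.
have l1 x : linear (fun a => dmul x a) by move=> z u v; rewrite dmulDr dmulZr.
have l2 : linear (fun a : diffop => a) by [].
apply: (do_ind (l1 _) l2) => e P [r s]; rewrite dmulDl !tDM /= -polyC1 comp_polyC polyC1 mul1r !add0r.
by case: r; rewrite ?add0r ?addr0.
Qed.
Lemma dmul1r : right_id (dop 0 1) dmul.
Proof.
have l1 x : linear (fun a => dmul a x) by move=> z u v; rewrite dmulDl dmulZl.
have l2 : linear (fun a : diffop => a) by [].
apply: (do_ind (l1 _) l2) => e P [r s].
rewrite dmulDr !tDM /= sh0 comp_polyXr mulr1 !addr0.
by case: s; rewrite ?add0r ?addr0.
Qed.
Lemma dop1_neq0 : dop 0 1 != 0.
Proof.
apply/eqP => /malgP /(_ (0, 0%N, (false, false))).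
rewrite mcoeffD !tDE mcoeff0 /= coef1 addr0 => /eqP.
by rewrite oner_eq0.
Qed.
HB.instance Definition _ := GRing.Zmodule_isNzRing.Build diffop
  dmulA dmul1l dmul1r dmulDl dmulDr dop1_neq0.
HB.instance Definition _ := GRing.Lmodule_isLalgebra.Build K diffop
  (fun x a b => esym (dmulZl x a b)).
HB.instance Definition _ := GRing.Lalgebra_isAlgebra.Build K diffop
  (fun x a b => esym (dmulZr x a b)).


Definition ipar (k : doidx) : bool := k.2.1 (+) k.2.2.
Definition homog p (a : diffop) : bool := all (fun k => ipar k == p) (msupp a).

(* bilinear extension of [a, b] = ab - (-1)^(p(a)p(b)) ba from basis elements,
   which are homogeneous; see sbr_homog *)
Definition sbr_basis (i j : doidx) : diffop :=
  let: (a, b) := (<< i >> : diffop, << j >> : diffop) in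
  a * b - (-1) ^+ (ipar i && ipar j) *: (b * a).
Definition sbr (a b : diffop) : diffop :=
  linext (fun i => linext (sbr_basis i) b) a.

(* integral powers of t in the even part, half-integral ones in the odd part;
   a factor D is required in front of d/dtheta theta and of theta *)
Definition SDNS_idx (k : doidx) : bool :=
  let: (e, l, (r, s)) := k in (odd `|e| == r (+) s) && (s || (0 < l)%N).
Definition in_SDNS (a : diffop) : bool := all SDNS_idx (msupp a).

(* - D - k with k = e/2 *)
Definition fl (e : int) : {poly K} := - 'X - (e%:~R / 2%:R)%:P.

(* The value 0 is only taken on basis elements outside of SD_NS; gammaE is the
   defining formula of gamma on t^k P(D) D^(0 or 1) E_c. *)
Definition gamma_basis (k : doidx) : diffop :=
  let: (e, l, c) := k in
  match c with
  | (false, false) => if l is l'.+1 then tD e (false, false) (fl e ^+ l' * 'X) else 0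
  | (true, true) => - tD e (true, true) (fl e ^+ l)
  | (true, false) => if l is l'.+1 then tD e (false, true) (fl e ^+ l') else 0
  | (false, true) => tD e (true, false) (fl e ^+ l * 'X)
  end.
Definition gamma : diffop -> diffop := linext gamma_basis.
HB.instance Definition _ := GRing.Linear.copy gamma (linext gamma_basis).

Definition xf (s : bool) : {poly K} := if s then 1 else 'X.
(* t^(e/2) P(D) E_c, with the extra factor D when E_c requires it *)
Definition gen c e P := tD e c (P * xf c.2).

Lemma gen_linear c e : linear (gen c e).
Proof. by move=> x P Q; rewrite /gen mulrDl -scalerAl tD_linear. Qed.
HB.instance Definition _ c e :=
  GRing.isLinear.Build K {poly K} diffop *:%R (gen c e) (gen_linear c e).

Lemma genXn c e l : gen c e 'X^l = mono e (l + ~~ c.2)%N c.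
Proof.
case: c => r []; rewrite /gen /=; first (rewrite mulr1 tDXn; by rewrite addn0).
by rewrite -exprSr tDXn addn1.
Qed.

Lemma SDNS_idxP k : SDNS_idx k ->
  exists c e l, [/\ odd `|e| = c.1 (+) c.2 & << k >> = gen c e 'X^l].
Proof.
case: k => [[e l] [r s]] /= /andP[/eqP pe]; case: s pe => /= pe lp.
  by exists (r, true), e, l; rewrite genXn addn0.
by exists (r, false), e, l.-1; rewrite genXn addn1 prednK.
Qed.

Lemma poly_linear_eq (f g : {poly K} -> diffop) : linear f -> linear g ->
  (forall l, f 'X^l = g 'X^l) -> f =1 g.
Proof.
move=> lf lg H a.
pose F := GRing.isLinear.Build K {poly K} diffop *:%R f lf.
pose G := GRing.isLinear.Build K {poly K} diffop *:%R g lg.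
pose f' : {linear {poly K} -> diffop} := HB.pack f F.
pose g' : {linear {poly K} -> diffop} := HB.pack g G.
rewrite -[a]coefK poly_def.
rewrite -[LHS]/(f' _) -[RHS]/(g' _) !linear_sum; apply: eq_bigr => i _.
by rewrite !linearZ /= H.
Qed.

Lemma gammaE c e P : gamma (gen c e P) =
  (-1) ^+ (c.1 && c.2) *: gen (c.2, c.1) e (P \Po fl e).
Proof.
move: P; apply: poly_linear_eq.
- by move=> x P Q; rewrite linearP linearP.
- move=> x P Q; rewrite comp_polyD comp_polyZ linearP scalerDr.
  by rewrite !scalerA mulrC.
move=> l; rewrite genXn /gamma linextU /= comp_Xn_poly.
case: c => [[] []] /=; rewrite ?addn0 ?addn1 /gen /= ?expr0 ?expr1 ?scale1r ?mulr1 //.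
by rewrite scaleN1r.
Qed.

Lemma genM c d e f P Q : gen c e P * gen d f Q =
  if c.2 == d.1 then gen (c.1, d.2) (e + f) ((P \Po sh f) * (xf c.2 \Po sh f) * Q)
  else 0.
Proof.
rewrite [LHS]tDM; case: eqP => // _.
by rewrite /gen /= comp_polyM !mulrA.
Qed.

Lemma sh_fl e f : sh f \Po fl (e + f) = fl e.
Proof.
rewrite /sh /fl comp_polyD comp_polyX comp_polyC -addrA; congr (_ + _).
by rewrite -polyCN -polyCD -polyCN; congr (_%:P); rewrite intrD mulrDl opprD addrNK.
Qed.
Lemma fl_sh e f : fl f \Po sh e = fl (e + f).
Proof.
rewrite /sh /fl -['X in LHS]scale1r -scaleNr comp_polyB comp_polyZ comp_polyX comp_polyC.
by rewrite scaleN1r intrD mulrDl polyCD !opprD !addrA scale1r.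
Qed.
Lemma xf_sign s e : xf s \Po fl e = (-1) ^+ (~~ s) *: (xf s \Po sh e).
Proof.
case: s => /=; first by rewrite -polyC1 !comp_polyC scale1r.
by rewrite expr1 !comp_polyX scaleN1r /fl /sh opprD.
Qed.

Lemma gammaM c d e f P Q : gamma (gen c e P * gen d f Q) =
  - ((-1) ^+ ((c.1 (+) c.2) && (d.1 (+) d.2)) *:
     (gamma (gen d f Q) * gamma (gen c e P))).
Proof.
rewrite !gammaE genM -scalerAl -scalerAr genM /= eq_sym.
case: eqP => [<-|_]; last by rewrite linear0 !scaler0 oppr0.
rewrite gammaE /= !comp_polyM -!comp_polyA sh_fl fl_sh addrC xf_sign.
rewrite [f + e]addrC.
set A := _ \Po _; set B := _ \Po _; set C := _ \Po _.
have -> : A * (((-1) ^+ ~~ d.1) *: B) * C = ((-1) ^+ ~~ d.1) *: (C * B * A).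
  by rewrite -scalerAr -scalerAl; congr (_ *: _); ring.
rewrite linearZ /= !scalerA -scaleNr; congr (_ *: _).
by clear A B C; case: c d => [[] ?] [[] []]; rewrite /= ?expr0 ?expr1; ring.
Qed.


Lemma sbrE a b : sbr a b =
  \sum_(i <- msupp a) \sum_(j <- msupp b) (a@_i * b@_j) *: sbr_basis i j.
Proof.
rewrite /sbr /linext; apply: eq_bigr => i _; rewrite scaler_sumr.
by apply: eq_bigr => j _; rewrite scalerA.
Qed.

Lemma sbr_linearl b : linear (sbr^~ b).
Proof. by move=> x u v; rewrite /sbr linearP. Qed.

Lemma sbr_linearr a : linear (sbr a).
Proof.
move=> x u v; rewrite /sbr -linextZf -linextDf /linext; apply: eq_bigr => i _.
by congr (_ *: _); exact: (linearP (linext _)).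
Qed.

Lemma supp_ind (f g : diffop -> diffop) a : linear f -> linear g ->
  (forall k, k \in msupp a -> f << k >> = g << k >>) -> f a = g a.
Proof.
move=> lf lg H.
pose F := GRing.isLinear.Build K diffop diffop *:%R f lf.
pose G := GRing.isLinear.Build K diffop diffop *:%R g lg.
pose f' : {linear {malg K[doidx]} -> diffop} := HB.pack f F.
pose g' : {linear {malg K[doidx]} -> diffop} := HB.pack g G.
exact: (@malg_linear_eq _ _ _ f' g').
Qed.

Lemma sbr_homog p q a b : homog p a -> homog q b ->
  sbr a b = a * b - (-1) ^+ (p && q) *: (b * a).
Proof.
move=> ha hb.
have lr (c : diffop) : linear (fun b => c * b - (-1) ^+ (p && q) *: (b * c)).
  move=> x u v; rewrite mulrDr mulrDl -scalerAr -scalerAl scalerDr scalerBr.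
  by rewrite opprD addrACA !scalerA [x * _]mulrC.
have ll (c : diffop) : linear (fun a => a * c - (-1) ^+ (p && q) *: (c * a)).
  move=> x u v; rewrite mulrDr mulrDl -scalerAr -scalerAl scalerDr scalerBr.
  by rewrite opprD addrACA !scalerA [x * _]mulrC.
apply: (supp_ind (sbr_linearl b) (ll b)) => i ia.
apply: (supp_ind (sbr_linearr _) (lr _)) => j jb.
rewrite /sbr !linextU /sbr_basis.
by rewrite (eqP (allP ha i ia)) (eqP (allP hb j jb)).
Qed.

Lemma homog_tD c e P : homog (c.1 (+) c.2) (tD e c P).
Proof.
apply/allP => k; rewrite -mcoeff_neq0 tDE /ipar.
by have [->|] := eqVneq c k.2; rewrite ?andbF ?eqxx ?andbF //= mulr0n eqxx.
Qed.

Lemma in_SDNSP a : reflect (forall k, a@_k != 0 -> SDNS_idx k) (in_SDNS a).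
Proof.
apply: (iffP allP) => H k; first by rewrite mcoeff_neq0; apply: H.
by rewrite -mcoeff_neq0; apply: H.
Qed.

Lemma in_SDNS_P x a b : in_SDNS a -> in_SDNS b -> in_SDNS (x *: a + b).
Proof.
move=> /in_SDNSP ha /in_SDNSP hb; apply/in_SDNSP => k; rewrite mcoeffD mcoeffZ.
have [a0|/ha//] := eqVneq a@_k 0.
by rewrite a0 mulr0 add0r; apply: hb.
Qed.
Lemma in_SDNS0 : in_SDNS 0.
Proof. by apply/in_SDNSP => k; rewrite mcoeff0 eqxx. Qed.
Lemma in_SDNSZ x a : in_SDNS a -> in_SDNS (x *: a).
Proof. by move=> ha; rewrite -[_ *: _]addr0 in_SDNS_P ?in_SDNS0. Qed.
Lemma in_SDNSD a b : in_SDNS a -> in_SDNS b -> in_SDNS (a + b).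
Proof. by move=> ha hb; rewrite -[a]scale1r in_SDNS_P. Qed.

Lemma in_SDNS_gen c e P : odd `|e| = c.1 (+) c.2 -> in_SDNS (gen c e P).
Proof.
move=> pe; apply/in_SDNSP => -[[f l] d]; rewrite /gen tDE /=.
have [<-|] := eqVneq e f; last by rewrite eqxx.
have [<-|] := eqVneq c d; last by rewrite eqxx.
case: c pe => r [] -> /=; rewrite eqxx //= mulr1n coefMX.
by case: l => //=; rewrite eqxx.
Qed.

Lemma oddzD (e f : int) : odd `|e + f| = odd `|e| (+) odd `|f|.
Proof. lia. Qed.

Lemma in_SDNS_genM c d e f P Q : odd `|e| = c.1 (+) c.2 -> odd `|f| = d.1 (+) d.2 ->
  in_SDNS (gen c e P * gen d f Q).
Proof.
move=> pe pf; rewrite genM; case: eqP => [cd|_]; last exact: in_SDNS0.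
apply: in_SDNS_gen; rewrite oddzD pe pf cd /=.
by case: (c.1) (d.1) (d.2) => [] [] [].
Qed.

Lemma sbr_gen c d e f P Q : sbr (gen c e P) (gen d f Q) =
  gen c e P * gen d f Q -
  (-1) ^+ ((c.1 (+) c.2) && (d.1 (+) d.2)) *: (gen d f Q * gen c e P).
Proof. by apply: sbr_homog; apply: homog_tD. Qed.

Lemma in_SDNS_sbr a b : in_SDNS a -> in_SDNS b -> in_SDNS (sbr a b).
Proof.
move=> /allP ha /allP hb; rewrite sbrE.
rewrite big_seq; apply: (big_ind in_SDNS in_SDNS0 in_SDNSD) => i ia.
rewrite big_seq; apply: (big_ind in_SDNS in_SDNS0 in_SDNSD) => j jb.
apply: in_SDNSZ.
have -> : sbr_basis i j = sbr << i >> << j >> by rewrite /sbr !linextU.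
have [c [e [l [pe ->]]]] := SDNS_idxP (ha _ ia).
have [d [f [m [pf ->]]]] := SDNS_idxP (hb _ jb).
rewrite sbr_gen addrC -scaleNr; apply: in_SDNS_P; exact: in_SDNS_genM.
Qed.

Lemma gamma_sbr a b : in_SDNS a -> in_SDNS b ->
  gamma (sbr a b) = sbr (gamma a) (gamma b).
Proof.
move=> /allP ha /allP hb.
have l1 (z : diffop) : linear (fun y => gamma (sbr y z)).
  by move=> x u v; rewrite sbr_linearl linearP.
have l2 (z : diffop) : linear (fun y => sbr (gamma y) z).
  by move=> x u v; rewrite linearP sbr_linearl.
have l3 (z : diffop) : linear (fun y => gamma (sbr z y)).
  by move=> x u v; rewrite sbr_linearr linearP.
have l4 (z : diffop) : linear (fun y => sbr z (gamma y)).
  by move=> x u v; rewrite linearP sbr_linearr.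
apply: (supp_ind (l1 b) (l2 _)) => i ia.
apply: (supp_ind (l3 _) (l4 _)) => j jb.
have [c [e [l [pe ->]]]] := SDNS_idxP (ha _ ia).
have [d [f [m [pf ->]]]] := SDNS_idxP (hb _ jb).
move: ('X^l) ('X^m) => P Q.
rewrite sbr_gen linearB linearZ /= !gammaM !gammaE.
have genZ x c' e' R : x *: gen c' e' R = gen c' e' (x *: R) by rewrite linearZ.
rewrite !genZ (@sbr_homog (c.1 (+) c.2) (d.1 (+) d.2)); first last.
- by rewrite addbC; apply: (homog_tD (d.2, d.1)).
- by rewrite addbC; apply: (homog_tD (c.2, c.1)).
rewrite scalerN opprK addrC scalerA; congr (_ - _).
by rewrite [(d.1 (+) d.2) && _]andbC -expr2 sqrr_sign scale1r.
Qed.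

Definition in_SDNSplus (a : diffop) : bool := in_SDNS a && (gamma a == a).

Lemma in_SDNSplus_submod : submod_closed in_SDNSplus.
Proof.
split=> [|x a b]; first by rewrite /in_mem /= /in_SDNSplus in_SDNS0 linear0 eqxx.
move=> /andP[ha /eqP ga] /andP[hb /eqP gb]; apply/andP; split.
  exact: in_SDNS_P.
by rewrite linearP /= ga gb.
Qed.
HB.instance Definition _ :=
  GRing.isSubmodClosed.Build K diffop in_SDNSplus in_SDNSplus_submod.

Record SDNSplus := MkSDNSplus { SDNSval :> diffop; _ : in_SDNSplus SDNSval }.
HB.instance Definition _ := [isSub for SDNSval].
HB.instance Definition _ := [Choice of SDNSplus by <:].
HB.instance Definition _ := [SubChoice_isSubLmodule of SDNSplus by <:].

Lemma in_SDNSplus_sbr (a b : SDNSplus) : in_SDNSplus (sbr (SDNSval a) (SDNSval b)).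
Proof.
case: a b => a /= /andP[ha /eqP ga] [b /= /andP[hb /eqP gb]].
by rewrite /in_SDNSplus in_SDNS_sbr //= gamma_sbr // ga gb.
Qed.
Definition sbrp (a b : SDNSplus) : SDNSplus := MkSDNSplus (in_SDNSplus_sbr a b).

Definition Dd : diffop := dop 0 'X.
Definition tpow (e : int) : diffop := dop e 1.
Definition theta : diffop := mono 0 0 (true, false).
Definition dtheta : diffop := mono 0 0 (false, true).

Lemma tDM' e e' P Q c d : tD e c P * tD e' d Q =
  if c.2 == d.1 then tD (e + e') (c.1, d.2) ((P \Po sh e') * Q) else 0.
Proof. exact: tDM. Qed.
Lemma dopM e f P Q : dop e P * dop f Q = dop (e + f) ((P \Po sh f) * Q).
Proof. by rewrite /dop mulrDl !mulrDr !tDM' /= addr0 add0r. Qed.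
Lemma dopDl e P Q : dop e (P + Q) = dop e P + dop e Q.
Proof. by rewrite /dop !linearD /= addrACA. Qed.
Lemma dopZ e x P : dop e (x *: P) = x *: dop e P.
Proof. by rewrite /dop !linearZ /= scalerDr. Qed.
Lemma dop_exp P n : dop 0 P ^+ n = dop 0 (P ^+ n).
Proof.
elim: n => [|n IH]; first by rewrite !expr0.
by rewrite !exprS IH dopM sh0 comp_polyXr.
Qed.
Lemma thetaE : theta = tD 0 (true, false) 1.
Proof. by rewrite -(expr0 'X) tDXn. Qed.
Lemma dthetaE : dtheta = tD 0 (false, true) 1.
Proof. by rewrite -(expr0 'X) tDXn. Qed.
Lemma clifford : [/\ theta * dtheta + dtheta * theta = 1, theta ^+ 2 = 0,
  dtheta ^+ 2 = 0 & Dd * theta = theta * Dd].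
Proof.
have one : (1 : diffop) = dop 0 1 by [].
rewrite !expr2 thetaE dthetaE; split.
- by rewrite !tDM' /= sh0 comp_polyXr mulr1 addrC one.
- by rewrite tDM'.
- by rewrite tDM'.
rewrite /Dd /dop mulrDl mulrDr !tDM' /= sh0 !comp_polyXr mul1r mulr1.
by rewrite !(addr0, add0r).
Qed.

(* coefficient of y^i in exp(s y D) *)
Definition ey (s : K) (i : nat) : diffop := (s ^+ i / i`!%:R) *: Dd ^+ i.
(* coefficient of y1^i y2^j x^(-e/2) in exp(-y1 D) delta(t/x) exp(y2 D) for e
   even, and in exp(-y1 D) delta_(1/2)(t/x) exp(y2 D) for e odd *)
Definition edelta (e : int) (i j : nat) : diffop := ey (-1) i * tpow e * ey 1 j.

Definition Qp e i j : {poly K} :=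
  ((-1) ^+ i / i`!%:R * (1 ^+ j / j`!%:R)) *: (sh e ^+ i * 'X^j).

Lemma edeltaE e i j : edelta e i j = dop e (Qp e i j).
Proof.
rewrite /edelta /ey /tpow /Dd !dop_exp -!dopZ !dopM add0r addr0 sh0 comp_polyXr.
by rewrite mulr1 comp_polyZ comp_Xn_poly -scalerAl -scalerAr scalerA.
Qed.

Lemma Qp_fl e i j : Qp e i j \Po fl e = Qp e j i.
Proof.
rewrite /Qp comp_polyZ comp_polyM comp_Xn_poly.
have -> : sh e ^+ i \Po fl e = (-1) ^+ i *: 'X^i.
  rewrite -comp_Xn_poly -comp_polyA.
  have -> : sh e \Po fl e = - 'X.
    by have := sh_fl 0 e; rewrite add0r => ->; rewrite /fl mul0r subr0.
  by rewrite comp_Xn_poly -scaleN1r exprZn.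
have -> : fl e ^+ j = (-1) ^+ j *: sh e ^+ j.
  by rewrite -exprZn scaleN1r /fl /sh opprD.
rewrite -scalerAl -scalerAr !scalerA mulrC; congr (_ *: _); last by rewrite mulrC.
rewrite !expr1n; have := sqrr_sign K i.
set x := (-1) ^+ i; set y := (-1) ^+ j; set a := i`!%:R^-1; set b := j`!%:R^-1.
by rewrite expr2 => xx; ring: xx.
Qed.

Definition iota1 (A : diffop) : diffop := A * dtheta * theta.
Definition iota2 (A : diffop) : diffop := A * theta * dtheta.

(* Coefficients of y1^i y2^j x^(-n), resp. y1^i y2^j x^(-(m + 1/2)), in the
   generating functions.  Exchanging y1 and y2 in edelta exchanges i and j. *)
Definition calD_coef (n : int) (i j : nat) : diffop :=
  edelta (n *+ 2) i j * Dd + edelta (n *+ 2) j i * Dd.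
Definition calDbar_coef (n : int) (i j : nat) : diffop :=
  edelta (n *+ 2) i j - edelta (n *+ 2) j i.
Definition G_coef (m : int) (i j : nat) : diffop :=
  edelta (m *+ 2 + 1) i j * theta * Dd + edelta (m *+ 2 + 1) j i * dtheta.

Lemma oddz2 (n : int) : odd `|n *+ 2| = false.
Proof. lia. Qed.
Lemma oddz2S (n : int) : odd `|n *+ 2 + 1| = true.
Proof. lia. Qed.

Lemma in_SDNSplusD : {in in_SDNSplus &, forall a b, in_SDNSplus (a + b)}.
Proof. by move=> a b ha hb; exact: (rpredD ha hb). Qed.

Lemma dop_gen e P c : dop e P * gen c 0 1 = gen c e P.
Proof.
rewrite /gen mul1r /dop mulrDl !tDM' /= sh0 comp_polyXr addr0.
by case: c => [[] []]; rewrite /= ?addr0 ?add0r.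
Qed.

Lemma calDE n i j : iota1 (calD_coef n i j) =
  gen (false, false) (n *+ 2) (Qp (n *+ 2) i j + Qp (n *+ 2) j i).
Proof.
rewrite /iota1 -mulrA /calD_coef -mulrDl -mulrA !edeltaE -dopDl.
have -> : Dd * (dtheta * theta) = gen (false, false) 0 1.
  by rewrite thetaE dthetaE tDM' /= /Dd /dop mulrDl !tDM' /= /gen !sh0 !comp_polyXr !mulr1 mul1r !addr0.
exact: dop_gen.
Qed.

Lemma calDbarE n i j : iota2 (calDbar_coef n i j) =
  gen (true, true) (n *+ 2) (Qp (n *+ 2) i j - Qp (n *+ 2) j i).
Proof.
rewrite /iota2 -mulrA /calDbar_coef !edeltaE -scaleN1r -dopZ -dopDl scaleN1r.
have -> : theta * dtheta = gen (true, true) 0 1.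
  by rewrite thetaE dthetaE tDM' /= /gen sh0 comp_polyXr.
exact: dop_gen.
Qed.

Lemma GE m i j : G_coef m i j =
  gen (true, false) (m *+ 2 + 1) (Qp (m *+ 2 + 1) i j) +
  gen (false, true) (m *+ 2 + 1) (Qp (m *+ 2 + 1) j i).
Proof.
rewrite /G_coef -mulrA !edeltaE; congr (_ + _).
  have -> : theta * Dd = gen (true, false) 0 1.
    by rewrite thetaE /Dd /dop mulrDr !tDM' /= /gen sh0 comp_polyXr !addr0.
  exact: dop_gen.
have -> : dtheta = gen (false, true) 0 1 by rewrite dthetaE /gen mulr1.
exact: dop_gen.
Qed.

Lemma in_SDNSplus_calD n i j : in_SDNSplus (iota1 (calD_coef n i j)).
Proof.
rewrite calDE /in_SDNSplus in_SDNS_gen ?oddz2 //= gammaE expr0 scale1r /=.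
by rewrite comp_polyD !Qp_fl addrC.
Qed.
Lemma in_SDNSplus_calDbar n i j : in_SDNSplus (iota2 (calDbar_coef n i j)).
Proof.
rewrite calDbarE /in_SDNSplus in_SDNS_gen ?oddz2 //= gammaE expr1 scaleN1r /=.
by rewrite comp_polyB !Qp_fl -linearN opprB.
Qed.
Lemma in_SDNSplus_G m i j : in_SDNSplus (G_coef m i j).
Proof.
rewrite GE /in_SDNSplus in_SDNSD ?in_SDNS_gen ?oddz2S //= linearD /= !gammaE.
by rewrite !expr0 !scale1r /= !Qp_fl addrC.
Qed.

Definition calD n i j : SDNSplus := MkSDNSplus (in_SDNSplus_calD n i j).
Definition calDbar n i j : SDNSplus := MkSDNSplus (in_SDNSplus_calDbar n i j).
Definition calG m i j : SDNSplus := MkSDNSplus (in_SDNSplus_G m i j).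

End DiffOp.

Section Fock.
Context (K : numFieldType).

(* (m, S) with S = {i_1 < ... < i_p} stands for
   prod_i h(-(i+1))^(m i) (x) phi(-i_1-1/2) /\ ... /\ phi(-i_p-1/2). *)
Definition Widx : choiceType := ({cmonom nat} * {fset nat})%type.
Definition W := {malg K[Widx]}.
HB.instance Definition _ := GRing.Lmodule.on W.

Definition Wmono (m : {cmonom nat}) (S : {fset nat}) : W := << (m, S) : Widx >>.

(* h(n) is multiplication by the variable h(n) for n < 0, and n d/dh(-n) for
   n > 0 (the truncated division by ucm i only matters when b.1 i > 0) *)
Definition h_basis (n : int) (b : Widx) : W :=
  match n with
  | Posz 0 => 0
  | Posz i.+1 => (i.+1 * b.1 i)%:R *: Wmono (divcm b.1 (ucm i)) b.2
  | Negz i => Wmono (mulcm b.1 (ucm i)) b.2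
  end.
Definition h (n : int) : {linear W -> W} := linext (h_basis n).

(* phi_basis r is phi(r + 1/2): the exterior product by phi(r + 1/2) for r < 0,
   and the contraction (odd derivation) dual to phi(-r-1/2) for r >= 0 *)
Definition phi_basis (r : int) (b : Widx) : W :=
  let sgn i : K := (-1) ^+ #|` [fset k in b.2 | (k < i)%N]%fset | in
  match r with
  | Posz i => if i \in b.2 then sgn i *: Wmono b.1 (b.2 `\ i)%fset else 0
  | Negz i => if i \in b.2 then 0 else sgn i *: Wmono b.1 (i |` b.2)%fset
  end.
Definition phi (r : int) : {linear W -> W} := linext (phi_basis r).

Definition Whomog (p : bool) (w : W) : bool :=
  all (fun b : Widx => odd #|` b.2 | == p) (msupp w).

Definition nohh (m n : int) (w : W) : W :=
  if m <= n then h m (h n w) else h n (h m w).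
Definition nophiphi (r s : int) (w : W) : W :=
  if r <= s then phi r (phi s w) else - phi s (phi r w).

(* coefficient of y^i in exp(a y) *)
Definition ecoef (a : K) (i : nat) : K := a ^+ i / i`!%:R.
Definition half (r : int) : K := r%:~R + 2%:R^-1.

(* X(x) = s * sum_n h(n) x^(-n), with a normalisation constant s, and
   X~(x) = sum_n phi(n) x^(-n).  As X(e^y x) = s * sum_m e^(-m y) h(m) x^(-m),
   and likewise for X~, the coefficient of y1^i y2^j x^(-n), resp.
   y1^i y2^j x^(-(m + 1/2)), in the three quadratic series below is the sum
   over all k in Z of the family XX s n i j k, resp. XtXt n i j k and
   XtX s m i j k; the second factor has mode k for XX and XtX, and mode k + 1/2
   for XtXt. *)
Definition XX (s : K) (n : int) (i j : nat) (k : int) (w : W) : W :=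
  (s ^+ 2 * (ecoef (- (n - k)%:~R) i * ecoef (- k%:~R) j)) *: nohh (n - k) k w.
Definition XtXt (n : int) (i j : nat) (k : int) (w : W) : W :=
  (ecoef (- half (n - 1 - k)) i * ecoef (- half k) j) *: nophiphi (n - 1 - k) k w.
Definition XtX (s : K) (m : int) (i j : nat) (k : int) (w : W) : W :=
  (s * (ecoef (- half (m - k)) i * ecoef (- k%:~R) j)) *: phi (m - k) (h k w).

(* T is the sum of the family F, which is finite on each vector *)
Definition is_lfsum (F : int -> W -> W) (T : W -> W) : Prop :=
  forall w, exists2 s : {fset int},
    forall k, k \notin s -> F k w = 0 & T w = \sum_(k <- s) F k w.

(* Psi is linear and, coefficientwise, maps D^(y1,y2)(x) to
   :X(e^y1 x)X(e^y2 x):, Dbar^(y1,y2)(x) to :X~(e^y1 x)X~(e^y2 x): and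
   G^(y1,y2)(x) to X~(e^y1 x)X(e^y2 x).
   About the normalisation s of X: D^(0,0) has coefficients 2 t^n D, mapped to
   2 s^2 L(n) where L(n) = 1/2 sum_k :h(n-k)h(k):.  Since
   [t^m D, t^n D] = (n - m) t^(m+n) D while [L(m), L(n)] = (m - n) L(m+n) up to
   scalars, Psi can respect brackets only if s^2 = -1. *)
Definition generating_spec (s : K)
    (Psi : SDNSplus K -> {linear W -> W}) : Prop :=
  [/\ forall x a b w, Psi (x *: a + b) w = x *: Psi a w + Psi b w,
      forall n i j, is_lfsum (XX s n i j) (Psi (calD K n i j)),
      forall n i j, is_lfsum (XtXt n i j) (Psi (calDbar K n i j))
    & forall m i j, is_lfsum (XtX s m i j) (Psi (calG K m i j))].

Definition projective_rep (Psi : SDNSplus K -> {linear W -> W}) : Prop :=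
  [/\ forall x a b w, Psi (x *: a + b) w = x *: Psi a w + Psi b w,
      forall p q (a : SDNSplus K) w,
        homog p (SDNSval a) -> Whomog q w -> Whomog (p (+) q) (Psi a w)
    & forall p q (a b : SDNSplus K),
        homog p (SDNSval a) -> homog q (SDNSval b) ->
        exists c : K, forall w,
          Psi a (Psi b w) - (-1) ^+ (p && q) *: Psi b (Psi a w) =
          Psi (sbrp a b) w + c *: w].

End Fock.

(* Main.v *)
Require Import Defs.
From HB Require Import structures.
From mathcomp Require Import all_boot all_order all_algebra.
From mathcomp Require Import finmap monalg complex reals.
From mathcomp Require Import zify ring.
Import Order.TTheory GRing.Theory Num.Theory.
Set Implicit Arguments. Unset Strict Implicit. Unset Printing Implicit Defensive.
Local Open Scope ring_scope.

(** The operators h(n), and phi(r) for half-integral r, stand for the functions t^n and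
    t^r theta: put mode(t^n) = h(n) and mode(t^r theta) = - s phi(r), where s^2 = -1.
    The algebra of differential operators acts on these functions, and the point
    of the construction is that, for a in SD_NS+ acting by its quadratic
    expression psi(a) and for every function u,

       psi(a) mode(u) = (-1)^(p(a)p(u)) mode(u) psi(a) + mode(a u).

    No other commutator has to be computed: the super commutator
    of a quadratic monomial with a mode has at most two terms, so summing the
    locally finite series is immediate ([opH_h], [opF_phi], [opM_h], [opM_phi]),
    and the two terms are the ones produced by x and by gamma(x) when x is a
    generator of SD_NS ([psi_ext_gen_mode]); on gamma-fixed elements they add up
    to the action of a ([psi_ext_mode]).

    Since u |-> a u is a representation of the associative algebra ([act_mul]),
    the Jacobi identity shows that the defect
       [psi(a), psi(b)] - psi([a, b])
    super-commutes with every mode ([defect_mode]).  W is generated by the vacuum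
    under the creation operators, and up to scalars the vacuum is the only vector
    killed by all annihilation operators, so such an operator is a scalar
    ([fock_schur]).  The cocycle itself is never computed.

    That psi is given by the stated generating functions comes from two remarks:
    the coefficient of y1^i y2^j in exp(- y1 (D + n)) exp(y2 D), evaluated at
    D = - k, is the weight of the mode pair (n - k, k) ([Qp_horner]); and
    exchanging the two factors of a pair is the substitution D -> - D - n, that
    is, gamma up to sign ([opH_fl], [opF_fl]).  Uniqueness holds because the coefficients
    with a zero exponent of y1 or of y2 already span SD_NS+ ([SDNSplus_span]). *)

(** * Linear maps on free modules *)

Section Generic.
Context {K : numFieldType}.

Lemma malg_linear_ext (B : choiceType) (V : lmodType K) (f g : {malg K[B]} -> V) a :
  linear f -> linear g -> (forall k, k \in msupp a -> f << k >> = g << k >>) ->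
  f a = g a.
Proof.
move=> lf lg H.
pose F := GRing.isLinear.Build K {malg K[B]} V *:%R f lf.
pose G := GRing.isLinear.Build K {malg K[B]} V *:%R g lg.
pose f' : {linear {malg K[B]} -> V} := HB.pack f F.
pose g' : {linear {malg K[B]} -> V} := HB.pack g G.
exact: (@malg_linear_eq _ _ _ f' g').
Qed.

Section LinearMaps.
Context {U V : lmodType K} {f : U -> V} (lf : linear f).

Lemma lin0 : f 0 = 0.
Proof. by have := lf (-1) 0 0; rewrite !scaleN1r !addNr. Qed.
Lemma linZ c x : f (c *: x) = c *: f x.
Proof. by have := lf c x 0; rewrite lin0 !addr0. Qed.
Lemma linD x y : f (x + y) = f x + f y.
Proof. by have := lf 1 x y; rewrite !scale1r. Qed.
Lemma linB x y : f (x - y) = f x - f y.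
Proof. by rewrite -scaleN1r linD linZ scaleN1r. Qed.
End LinearMaps.

Section LinearCombinations.
Context {U V : lmodType K}.

Lemma linear_comb (f g : U -> V) (z t : K) :
  linear f -> linear g -> linear (fun x => z *: f x + t *: g x).
Proof.
move=> lf lg d x y; rewrite lf lg !scalerDr !scalerA [z * d]mulrC [t * d]mulrC.
by rewrite addrACA.
Qed.

Lemma linear_scale (z : K) (f : U -> V) : linear f -> linear (fun x => z *: f x).
Proof. by move=> lf d x y; rewrite lf scalerDr !scalerA [z * d]mulrC. Qed.

Lemma linear_opp (f : U -> V) : linear f -> linear (fun x => - f x).
Proof. by move=> lf c x y; rewrite lf opprD scalerN. Qed.
End LinearCombinations.

Lemma linear_sumZ (U V : lmodType K) (f : U -> V) (I : Type) (l : seq I)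
    (c : I -> K) (x : I -> U) : linear f ->
  f (\sum_(i <- l) c i *: x i) = \sum_(i <- l) c i *: f (x i).
Proof.
move=> lf; elim: l => [|i l IH]; first by rewrite !big_nil (lin0 lf).
by rewrite !big_cons lf IH.
Qed.

Lemma malgE (B : choiceType) (a : {malg K[B]}) :
  a = \sum_(k <- msupp a) a@_k *: << k >>.
Proof.
rewrite [LHS]monalgE; apply: eq_bigr => k _.
by apply/malgP => l; rewrite mcoeffZ !mcoeffU mulrnAr mulr1.
Qed.

Lemma poly_linear_ext (V : lmodType K) (f g : {poly K} -> V) :
  linear f -> linear g -> (forall l, f 'X^l = g 'X^l) -> f =1 g.
Proof.
move=> lf lg H a.
pose F := GRing.isLinear.Build K {poly K} V *:%R f lf.
pose G := GRing.isLinear.Build K {poly K} V *:%R g lg.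
pose f' : {linear {poly K} -> V} := HB.pack f F.
pose g' : {linear {poly K} -> V} := HB.pack g G.
rewrite -[a]coefK poly_def.
rewrite -[LHS]/(f' _) -[RHS]/(g' _) !linear_sum; apply: eq_bigr => i _.
by rewrite !linearZ /= H.
Qed.

Lemma linext_all (B : choiceType) (V : lmodType K) (P : V -> Prop)
    (f : B -> V) (a : {malg K[B]}) :
  P 0 -> (forall c x y, P x -> P y -> P (c *: x + y)) ->
  (forall k, k \in msupp a -> P (f k)) -> P (linext f a).
Proof.
move=> P0 PD Pf; rewrite /linext big_seq.
apply: (big_ind P) => // [x y Px Py|k ka]; first by rewrite -[x]scale1r; apply: PD.
by rewrite -[_ *: _]addr0; apply: PD => //; apply: Pf.
Qed.

Lemma eqN_eq0 (V : lmodType K) (x : V) : x = - x -> x = 0.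
Proof.
move=> /eqP; rewrite -addr_eq0 -mulr2n -scaler_nat scaler_eq0 pnatr_eq0 /=.
exact: eqP.
Qed.
End Generic.

(** * Heisenberg and Clifford modes *)

(** Opaque copies of the basis vectors and of the modes: they are only used
    through the rules below. *)
HB.lock Definition wbas (K : numFieldType) m S : W K := Wmono K m S.
HB.lock Definition hmode (K : numFieldType) (n : int) (w : W K) : W K := h K n w.
HB.lock Definition phimode (K : numFieldType) (r : int) (w : W K) : W K := phi K r w.

(** Both phi(i + 1/2) and phi(- i - 1/2) toggle the exterior generator number i;
    [site] is that number, and the two modes differ in where they vanish. *)
Definition flip (i : nat) (S : {fset nat}) : {fset nat} :=
  (if i \in S then S `\ i else i |` S)%fset.
Definition site (r : int) : nat := match r with Posz i => i | Negz i => i end.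

Section FockModes.
Context {K : numFieldType}.
Local Notation W := (W K).
Local Notation h := (@hmode K).
Local Notation phi := (@phimode K).
Local Notation wbas := (@wbas K).
Implicit Types (w : W) (m : {cmonom nat}) (S : {fset nat}) (i j : nat) (n r s : int).

(** The Koszul sign for reaching the generator number i. *)
Definition fsgn i S : K := (-1) ^+ #|` [fset k in S | (k < i)%N]%fset |.

Lemma hmode_linear n : linear (h n).
Proof. by rewrite hmode.unlock => c x y; rewrite linearP. Qed.
HB.instance Definition _ n := GRing.isLinear.Build K W W *:%R (h n) (hmode_linear n).
Lemma phimode_linear r : linear (phi r).
Proof. by rewrite phimode.unlock => c x y; rewrite linearP. Qed.
HB.instance Definition _ n := GRing.isLinear.Build K W W *:%R (phi n) (phimode_linear n).

Lemma hZ n c w : h n (c *: w) = c *: h n w. Proof. exact: linearZZ. Qed.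
Lemma phiZ r c w : phi r (c *: w) = c *: phi r w. Proof. exact: linearZZ. Qed.
Lemma hD n x y : h n (x + y) = h n x + h n y. Proof. exact: linearD. Qed.
Lemma hB n x y : h n (x - y) = h n x - h n y. Proof. exact: linearB. Qed.
Lemma phiD r x y : phi r (x + y) = phi r x + phi r y. Proof. exact: linearD. Qed.
Lemma phiN r x : phi r (- x) = - phi r x. Proof. exact: linearN. Qed.
Lemma phiB r x y : phi r (x - y) = phi r x - phi r y. Proof. exact: linearB. Qed.
Lemma h_vec0 n : h n 0 = 0. Proof. exact: linear0. Qed.
Lemma phi_vec0 r : phi r 0 = 0. Proof. exact: linear0. Qed.

Lemma W_ext (f g : W -> W) : linear f -> linear g ->
  (forall m S, f (wbas m S) = g (wbas m S)) -> f =1 g.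
Proof.
by rewrite wbas.unlock => lf lg H w; apply: malg_linear_ext => // -[m S] _; apply: H.
Qed.

Lemma W_comp_linear (f g : {linear W -> W}) : linear (fun w => f (g w)).
Proof. by move=> c x y; rewrite !linearP. Qed.

Lemma linear_addZ (f : W -> W) a : linear f -> linear (fun w => f w + a *: w).
Proof.
move=> lf c x y; rewrite lf !scalerDr !scalerA [a * c]mulrC -!addrA.
by congr (_ + _); rewrite addrCA.
Qed.

Lemma h0 w : h 0 w = 0.
Proof. by rewrite hmode.unlock /Defs.h /= /linext big1 // => k _; rewrite scaler0. Qed.
Lemma h_ann i m S :
  h i.+1 (wbas m S) = (i.+1 * m i)%:R *: wbas (divcm m (ucm i)) S.
Proof. by rewrite hmode.unlock wbas.unlock /Defs.h /= linextU. Qed.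
Lemma h_cre i m S : h (Negz i) (wbas m S) = wbas (mulcm m (ucm i)) S.
Proof. by rewrite hmode.unlock wbas.unlock /Defs.h /= linextU. Qed.
Lemma phiE r m S : phi r (wbas m S) =
  if (site r \in S) == (0 <= r) then fsgn (site r) S *: wbas m (flip (site r) S) else 0.
Proof.
rewrite phimode.unlock wbas.unlock /Defs.phi /= linextU /flip.
by case: r => i /=; case: (i \in S).
Qed.

(** ** Boson modes *)

Lemma cm_ext (m m' : {cmonom nat}) : (forall i, m i = m' i) -> m = m'.
Proof. by move=> H; apply/eqP/cmP. Qed.

Lemma h_ann_ann i j w : h i.+1 (h j.+1 w) = h j.+1 (h i.+1 w).
Proof.
move: w; apply: W_ext; try exact: (W_comp_linear (h _) (h _)).
move=> m S; rewrite !(h_ann, hZ) !scalerA -!natrM; congr (_%:R *: wbas _ _).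
  by rewrite !divcmE !ucmE; case: eqVneq => [->|]; lia.
by apply: cm_ext => k; rewrite !divcmE; lia.
Qed.

Lemma h_cre_cre i j w : h (Negz i) (h (Negz j) w) = h (Negz j) (h (Negz i) w).
Proof.
move: w; apply: W_ext; try exact: (W_comp_linear (h _) (h _)).
by move=> m S; rewrite !h_cre -!mulcmA [mulcm (ucm _) _]mulcmC.
Qed.

Lemma h_ann_cre i j w :
  h i.+1 (h (Negz j) w) = h (Negz j) (h i.+1 w) + (i.+1 *+ (i == j))%:R *: w.
Proof.
move: w; apply: W_ext; first exact: (W_comp_linear (h _) (h _)).
  exact/linear_addZ/(W_comp_linear (h _) (h _)).
move=> m S; rewrite !(h_ann, h_cre, hZ) mulcmE ucmE.
have [<-|ne] := eqVneq i j.
  rewrite mulr1n.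
  have -> : divcm (mulcm m (ucm i)) (ucm i) = m.
    by apply: cm_ext => k; rewrite divcmE mulcmE addnK.
  case: (posnP (m i)) => [->|mi]; first by rewrite add0n muln0 scale0r add0r muln1.
  have -> : mulcm (divcm m (ucm i)) (ucm i) = m.
    apply: cm_ext => k; rewrite mulcmE divcmE ucmE; case: eqVneq => [<-|]; lia.
  by rewrite -scalerDl -natrD mulnDr muln1.
rewrite addn0 mulr0n scale0r addr0.
case: (posnP (m i)) => [->|mi]; first by rewrite muln0 !scale0r.
congr (_ *: wbas _ _); apply: cm_ext => k; rewrite divcmE !mulcmE divcmE !ucmE.
by case: eqVneq => [<-|]; case: eqVneq => [|]; lia.
Qed.

Lemma hh_comm n r w :
  h n (h r w) = h r (h n w) + (n%:~R *+ (n + r == 0)) *: w.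
Proof.
case: n => [[|i]|i]; case: r => [[|j]|j];
  rewrite ?h0 ?h_vec0 ?mulr0n ?mul0rn ?scale0r ?addr0 //.
- by rewrite h_ann_ann.
- rewrite h_ann_cre (_ : (Posz i.+1 + Negz j == 0) = (i == j)); last by lia.
  by case: eqP => _; rewrite ?mulr0n ?mulr1n.
- rewrite h_ann_cre (_ : (Negz i + Posz j.+1 == 0) = (i == j)); last by lia.
  rewrite -addrA -scalerDl [j == i]eq_sym.
  have [<-|ne] := eqVneq i j; last by rewrite !mulr0n addr0 scale0r addr0.
  by rewrite !mulr1n NegzE mulrNz subrr scale0r addr0.
- by rewrite h_cre_cre.
Qed.

(** ** Fermion modes *)

Lemma in_flip i j S : (j \in flip i S) = (i == j) (+) (j \in S).
Proof.
rewrite /flip; case: ifP => iS; rewrite !inE eq_sym; have [<-|] := eqVneq i j => //=.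
  by rewrite iS.
by rewrite iS.
Qed.

Lemma flipC i j S : flip i (flip j S) = flip j (flip i S).
Proof. by apply/fsetP => k; rewrite !in_flip addbCA. Qed.

Lemma flipK i S : flip i (flip i S) = S.
Proof. by apply/fsetP => k; rewrite !in_flip addbA addbb. Qed.

(** Toggling i changes the Koszul sign of j exactly when i comes before j; as one of
    i < j and j < i holds, modes at different sites anticommute. *)
Lemma fsgn_flip i j S : fsgn j (flip i S) = (-1) ^+ (i < j)%N * fsgn j S.
Proof.
have cre T : i \notin T ->
    fsgn j (i |` T)%fset = (-1) ^+ (i < j)%N * fsgn j T.
  move=> iT; rewrite /fsgn -exprD; congr (_ ^+ _).
  case: ltnP => ij; last first.
    rewrite add0n; congr #|` _|; apply/fsetP => k; rewrite !inE.
    by have [->|] := eqVneq k i => //=; rewrite ltnNge ij /= andbF.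
  rewrite (_ : [fset k in _ | _]%fset = i |` [fset k in T | (k < j)%N])%fset.
    by rewrite cardfsU1 !inE (negbTE iT).
  by apply/fsetP => k; rewrite !inE; have [->|] := eqVneq k i => //=; rewrite ij.
rewrite /flip; case: ifPn => iS; last exact: cre.
have := cre (S `\ i)%fset; rewrite !inE eqxx => /(_ isT).
by rewrite fsetD1K // => ->; rewrite mulrA -expr2 sqrr_sign mul1r.
Qed.

Lemma fsgn2 i S : fsgn i S * fsgn i S = 1.
Proof. by rewrite -expr2 sqrr_sign. Qed.

Lemma phiphi_comm r s w :
  phi r (phi s w) = - phi s (phi r w) + (r + s + 1 == 0)%:R *: w.
Proof.
move: w; apply: W_ext; first exact: (W_comp_linear (phi _) (phi _)).
  exact/linear_addZ/linear_opp/(W_comp_linear (phi _) (phi _)).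
move=> m S; rewrite !phiE !(fun_if (phi _)) !phi_vec0 !phiZ !phiE.
rewrite !(in_flip, flipC (site s)) ![fsgn _ (flip _ _)]fsgn_flip.
(* At a common site, exactly one of the two orders of creation and annihilation is
   nonzero on a given basis vector. *)
have [e|ne] := eqVneq (site r) (site s).
  rewrite -e ltnn expr0 mul1r flipK /=.
  have -> : (r + s + 1 == 0) = ((0 <= r) (+) (0 <= s)).
    by case: r s e => i [] j /= e; subst; lia.
  case: (site r \in S) (0 <= r) (0 <= s) => [] [] [] //=;
    by rewrite ?scaler0 ?scalerA ?fsgn2 ?scale0r ?scale1r ?oppr0 ?addr0 ?add0r ?addNr.
rewrite /=.
have -> : (r + s + 1 == 0) = false by case: r s ne => i [] j /= ne; lia.
rewrite scale0r addr0; case: eqP => _; case: eqP => _; rewrite ?scaler0 ?oppr0 // !scalerA.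
rewrite -scaleNr; congr (_ *: _).
by case: (ltngtP (site r) (site s)) ne => // _ _; rewrite ?expr0 ?expr1; ring.
Qed.

Lemma phi_h n r w : phi r (h n w) = h n (phi r w).
Proof.
move: w; apply: W_ext;
  [exact: (W_comp_linear (phi _) (h _))|exact: (W_comp_linear (h _) (phi _))|].
case: n => [[|i]|i] m S; first by rewrite !h0 phi_vec0.
  by rewrite h_ann phiZ !phiE; case: ifP; rewrite ?h_vec0 ?scaler0 // hZ h_ann !scalerA mulrC.
by rewrite h_cre !phiE; case: ifP; rewrite ?h_vec0 // hZ h_cre.
Qed.

(** The exponent r + 1/2 is never 0, so the anticommutator of phi(r) with itself vanishes. *)
Lemma phi_sqr r w : phi r (phi r w) = 0.
Proof.
have := phiphi_comm r r w; rewrite (_ : (r + r + 1 == 0) = false); last by lia.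
by rewrite scale0r addr0 => /eqN_eq0.
Qed.

End FockModes.

(** * Locally finite sums of operators *)

Definition bound (m : {cmonom nat}) (S : {fset nat}) : nat :=
  \max_(i <- finsupp m) i.+1 + \max_(i <- S) i.+1.

Definition window (N : nat) : {fset int} :=
  [fset k in [seq i%:Z - N%:Z | i <- iota 0 N.*2.+1]]%fset.

Lemma in_window N k : (k \in window N) = (`|k| <= N)%N.
Proof.
rewrite in_fset; apply/mapP/idP => [[j jN ->]|kN]; first by move: jN; rewrite mem_iota; lia.
by exists (absz (k + N%:Z)); rewrite ?mem_iota; lia.
Qed.

(** The sum over k of F k, computed on a basis vector over a window outside of
    which F k kills it; the constant C depends on F only. *)
HB.lock Definition lfop (K : numFieldType) (C : nat) (F : int -> W K -> W K) :
  W K -> W K :=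
  linext (fun b => \sum_(k <- window (C + bound b.1 b.2)) F k (wbas K b.1 b.2)).

Section LocallyFinite.
Context {K : numFieldType}.
Local Notation W := (W K).
Local Notation h := (@hmode K).
Local Notation phi := (@phimode K).
Local Notation wbas := (@wbas K).
Implicit Types (w : W) (m : {cmonom nat}) (S : {fset nat}) (i j : nat) (n r s k : int).
Implicit Types (F G : int -> W -> W) (T V : W -> W).

Lemma h_high m S k : (bound m S)%:Z < k -> h k (wbas m S) = 0.
Proof.
case: k => [[|i]|i] //; rewrite ltz_nat ltnNge => /negP lt.
rewrite h_ann (_ : m i = 0%N) ?muln0 ?scale0r //.
apply: fsfun_dflt; apply/negP => im.
apply: lt; apply: leq_trans (leq_addr _ _).
exact: (@leq_bigmax_seq _ _ predT succn _ im isT).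
Qed.

Lemma phi_high m S k : (bound m S)%:Z < k -> phi k (wbas m S) = 0.
Proof.
case: k => i //; rewrite ltz_nat ltnNge => /negP lt.
rewrite phiE /=; case: ifP => // /eqP iS.
case: lt; apply/ltnW/(leq_trans _ (leq_addl _ _)).
exact: (@leq_bigmax_seq _ _ predT succn _ iS isT).
Qed.

Lemma W_basE w : w = \sum_(b <- msupp w) w@_b *: wbas b.1 b.2.
Proof.
by rewrite wbas.unlock [LHS]malgE; apply: eq_bigr => -[m S] _.
Qed.

Lemma lfop_linear C F : linear (lfop C F).
Proof. by rewrite lfop.unlock => c x y; rewrite linearP. Qed.
HB.instance Definition _ C F :=
  GRing.isLinear.Build K W W *:%R (lfop C F) (lfop_linear C F).

Lemma big_fset_widen (A B : {fset int}) (f : int -> W) : (A `<=` B)%fset ->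
  (forall k, k \notin A -> f k = 0) -> \sum_(k <- A) f k = \sum_(k <- B) f k.
Proof. by move=> AB f0; apply: big_fset_incl => // k _; apply: f0. Qed.

Lemma lfsum_lfop C F : (forall k, linear (F k)) ->
  (forall m S k, (C + bound m S < `|k|)%N -> F k (wbas m S) = 0) ->
  is_lfsum F (lfop C F).
Proof.
move=> lF F0 w.
pose M := (\max_(b <- msupp w) (C + bound b.1 b.2))%N.
have leM b : b \in msupp w -> (C + bound b.1 b.2 <= M)%N.
  by move=> bw; apply: (@leq_bigmax_seq _ _ predT (fun b => C + bound b.1 b.2)%N _ bw).
exists (window M) => [k|].
  rewrite in_window -ltnNge => Mk; rewrite [w]W_basE linear_sumZ //.
  rewrite big_seq big1 // => b bw; rewrite F0 ?scaler0 //.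
  exact: leq_ltn_trans (leM b bw) Mk.
rewrite [in RHS](W_basE w); under [RHS]eq_bigr do rewrite linear_sumZ //.
rewrite exchange_big lfop.unlock /linext /= [LHS]big_seq [RHS]big_seq.
apply: eq_bigr => b bw; rewrite -scaler_sumr; congr (_ *: _).
apply: big_fset_widen => [|k]; last by rewrite in_window -ltnNge; apply: F0.
by apply/fsubsetP => k; rewrite !in_window => /leq_trans; apply; apply: leM.
Qed.

(** Identities between locally finite sums can be checked term by term: two
    operators with the same family are equal.  All commutators with the quadratic
    series below are computed in this way. *)
Lemma lfsum_unique F T T' : is_lfsum F T -> is_lfsum F T' -> T =1 T'.
Proof.
move=> FT FT' w; have [s s0 ->] := FT w; have [s' s0' ->] := FT' w.
by rewrite (big_fset_widen (fsubsetUl s s')) // (big_fset_widen (fsubsetUr s s')).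
Qed.

Lemma lfsum_ext F G T T' : (forall k w, F k w = G k w) -> T =1 T' ->
  is_lfsum F T -> is_lfsum G T'.
Proof.
move=> FG TT FT w; have [s s0 e] := FT w.
exists s; first by move=> k ks; rewrite -FG s0.
by rewrite -TT e; apply: eq_bigr => k _.
Qed.

Lemma lfsumD F G T T' : is_lfsum F T -> is_lfsum G T' ->
  is_lfsum (fun k w => F k w + G k w) (fun w => T w + T' w).
Proof.
move=> FT GT w; have [s s0 ->] := FT w; have [s' s0' ->] := GT w.
exists (s `|` s')%fset.
  by move=> k; rewrite inE negb_or => /andP[ks ks']; rewrite s0 // s0' // addr0.
rewrite (big_fset_widen (fsubsetUl s s')) // (big_fset_widen (fsubsetUr s s')) //.
by rewrite big_split.
Qed.

Lemma lfsum_post V F T : linear V -> is_lfsum F T ->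
  is_lfsum (fun k w => V (F k w)) (fun w => V (T w)).
Proof.
move=> lV FT w; have [s s0 ->] := FT w.
exists s; first by move=> k ks; rewrite s0 // (lin0 lV).
have := linear_sumZ s (fun=> 1) (F^~ w) lV.
by under eq_bigr do rewrite scale1r; under [X in _ = X]eq_bigr do rewrite scale1r.
Qed.

Lemma lfsum_pre V F T : is_lfsum F T ->
  is_lfsum (fun k w => F k (V w)) (fun w => T (V w)).
Proof. by move=> FT w; apply: FT. Qed.

Lemma lfsumZ c F T : is_lfsum F T -> is_lfsum (fun k w => c *: F k w) (fun w => c *: T w).
Proof.
by apply/(lfsum_post (V := fun w => c *: w))/linear_scale.
Qed.

Lemma lfsum_single n V : is_lfsum (fun k w => if k == n then V w else 0) V.
Proof.
move=> w; exists [fset n]%fset; first by move=> k; rewrite inE => /negbTE ->.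
by rewrite big_seq_fset1 eqxx.
Qed.

Lemma lfsum_reflect n F T : is_lfsum F T -> is_lfsum (fun k => F (n - k)) T.
Proof.
move=> FT w; have [s s0 ->] := FT w; pose f k := n - k.
have fK k : f (f k) = k by rewrite /f; lia.
exists (f @` s)%fset.
  move=> k ks; apply: s0; apply: contra ks => ks; apply/imfsetP.
  by exists (f k); rewrite ?fK.
rewrite big_imfset /=; last by move=> x y _ _ e; rewrite -[x]fK e fK.
by apply: eq_bigr => k _; rewrite -/(f (f k)) fK.
Qed.

(** * The Fock space is an irreducible module *)

Definition vac : W := wbas (onecm nat) fset0.

Lemma mcoeff_wbas m S b : (wbas m S)@_b = (((m, S) : Widx) == b)%:R.
Proof. by rewrite wbas.unlock mcoeffU. Qed.

Lemma mulcmK i m : (0 < m i)%N -> mulcm (divcm m (ucm i)) (ucm i) = m.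
Proof.
move=> mi; apply: cm_ext => k; rewrite mulcmE divcmE ucmE.
by case: eqVneq => [<-|]; lia.
Qed.

Lemma cm_neq1 m : onecm nat != m -> exists i, (0 < m i)%N.
Proof.
move=> ne; have [e|[k km]] := fset_0Vmem (finsupp m); last first.
  by move: km; rewrite mem_finsupp -lt0n; exists k.
case/eqP: ne; apply: cm_ext => i; rewrite onecmE fsfun_dflt //.
by rewrite e.
Qed.

(** An annihilation operator reads off the coefficients of w. *)
Lemma coef_h_ann i m S w : (0 < m i)%N ->
  (h i.+1 w)@_(divcm m (ucm i), S) = (i.+1 * m i)%:R * w@_(m, S).
Proof.
move=> mi.
apply: (@malg_linear_ext K _ K^o (fun w : W => (h i.+1 w)@_(divcm m (ucm i), S))
   (fun w : W => (i.+1 * m i)%:R * w@_(m, S))).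
- by move=> c x y; rewrite linearP mcoeffD mcoeffZ.
- move=> c x y; rewrite mcoeffD mcoeffZ mulrDr; congr (_ + _); exact: mulrCA.
move=> -[m' S'] _; have -> : << (m', S') >> = wbas m' S' by rewrite wbas.unlock.
rewrite h_ann mcoeffZ !mcoeff_wbas !xpair_eqE.
have [m'i|m'i] := posnP (m' i).
  rewrite m'i muln0 mul0r; case: (m' =P m) => [e|_]; last by rewrite mulr0.
  by rewrite -e m'i in mi.
case: (m' =P m) => [->|ne]; first by rewrite eqxx.
have -> : (divcm m' (ucm i) == divcm m (ucm i)) = false.
  by apply/eqP => e; apply: ne; rewrite -(mulcmK m'i) e mulcmK.
by rewrite !mulr0.
Qed.

Lemma coef_phi_ann i m S w : i \in S ->
  (phi i w)@_(m, flip i S) = fsgn i S * w@_(m, S).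
Proof.
move=> iS.
apply: (@malg_linear_ext K _ K^o (fun w : W => (phi i w)@_(m, flip i S))
   (fun w : W => fsgn i S * w@_(m, S))).
- by move=> c x y; rewrite linearP mcoeffD mcoeffZ.
- move=> c x y; rewrite mcoeffD mcoeffZ mulrDr; congr (_ + _); exact: mulrCA.
move=> -[m' S'] _; have -> : << (m', S') >> = wbas m' S' by rewrite wbas.unlock.
rewrite phiE /= mcoeff_wbas !xpair_eqE.
case: (boolP (i \in S')) => iS' /=; last first.
  rewrite mcoeff0; case: (S' =P S) => [e|_]; last by rewrite andbF mulr0.
  by rewrite e iS in iS'.
rewrite mcoeffZ mcoeff_wbas !xpair_eqE (inj_eq (can_inj (flipK i))).
case: (S' =P S) => [->//|_]; by rewrite andbF !mulr0.
Qed.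

(** Every basis vector other than the vacuum survives some annihilation operator,
    which therefore detects its coefficient in w. *)
Lemma vac_unique w : (forall i, h i.+1 w = 0) -> (forall i, phi i w = 0) ->
  w = w@_(onecm nat, fset0) *: vac.
Proof.
move=> hw fw; apply/malgP => -[m S]; rewrite mcoeffZ mcoeff_wbas xpair_eqE.
have [->|[i iS] ] := fset_0Vmem S; last first.
  rewrite [fset0 == S]eq_sym (_ : S == fset0 = false); last first.
    by apply/eqP => e; rewrite e in iS.
  rewrite andbF mulr0; have := coef_phi_ann m w iS; rewrite fw mcoeff0 => /esym/eqP.
  by rewrite mulf_eq0 signr_eq0 => /eqP.
have [<-|ne] := eqVneq (onecm nat) m; first by rewrite eqxx mulr1.
rewrite mulr0; have [i mi] := cm_neq1 ne.
have := coef_h_ann fset0 w mi; rewrite hw mcoeff0 => /esym/eqP.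
by rewrite mulf_eq0 pnatr_eq0 muln_eq0 /= -leqn0 leqNgt mi => /eqP.
Qed.

(** Every basis vector is, up to sign, a product of creation operators on the vacuum. *)
Lemma W_cyclic (Q : W -> Prop) : (forall c x y, Q x -> Q y -> Q (c *: x + y)) ->
  Q vac -> (forall i w, Q w -> Q (h (Negz i) w)) ->
  (forall i w, Q w -> Q (phi (Negz i) w)) -> forall w, Q w.
Proof.
move=> QD Qv Qh Qf w.
have Q0 : Q 0 by have := QD (-1) _ _ Qv Qv; rewrite scaleN1r addNr.
have QZ c x : Q x -> Q (c *: x) by move=> Qx; rewrite -[_ *: _]addr0; apply: QD.
suff Qb m S : Q (wbas m S).
  rewrite [w]W_basE; apply: (big_ind Q) => // [x y Qx Qy|b _]; last exact: QZ.
  by rewrite -[x]scale1r; apply: QD.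
have [N] := ubnP (mdeg m); elim: N m => // N IH m.
rewrite ltnS => mN; have [e|ne] := eqVneq (onecm nat) m.
  rewrite -e {m mN e IH}; have [M] := ubnP #|` S|; elim: M S => // M IH S SM.
  have [->//|[i iS] ] := fset_0Vmem S.
  have -> : wbas (onecm nat) S =
      fsgn i (flip i S) *: phi (Negz i) (wbas (onecm nat) (flip i S)).
    by rewrite phiE /= in_flip eqxx iS /= flipK scalerA fsgn2 scale1r.
  apply/QZ/Qf/IH; rewrite /flip iS.
  by move: SM; rewrite (cardfsD1 i S) iS add1n ltnS.
have [i mi] := cm_neq1 ne.
rewrite -(mulcmK mi) -h_cre; apply/Qh/IH.
apply: leq_trans mN; rewrite -{2}(mulcmK mi).
by rewrite (mdegM (divcm m (ucm i)) (ucm i)) mdegU addn1.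
Qed.

(** Schur's lemma for the Fock space: T vac is killed by all annihilation operators,
    hence is c vac, and the creation operators spread this to W.  An odd T
    anticommutes with the phi(r), which would alternate the sign of c; the last
    hypothesis forces c = 0 in that case. *)
Lemma fock_schur (p : bool) T : linear T ->
  (forall n w, T (h n w) = h n (T w)) ->
  (forall r w, T (phi r w) = (-1) ^+ p *: phi r (T w)) ->
  (p -> (T vac)@_(onecm nat, fset0) = 0) ->
  exists c : K, forall w, T w = c *: w.
Proof.
move=> lT Th Tf Tp; pose c := (T vac)@_(onecm nat, fset0).
have T0 := lin0 lT.
have Tv : T vac = c *: vac.
  apply: vac_unique => i; first by rewrite -Th h_ann onecmE muln0 scale0r.
  have : T (phi i vac) = 0 by rewrite phiE.
  by rewrite Tf => /eqP; rewrite scaler_eq0 signr_eq0 => /eqP.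
exists c; apply: W_cyclic => // [a x y ex ey|i w e|i w e].
- by rewrite lT ex ey scalerDr !scalerA mulrC.
- by rewrite Th e hZ.
rewrite Tf e phiZ scalerA; congr (_ *: _); rewrite /c.
by case: p Tp {Tf} => [->//|_]; rewrite ?mulr0 // expr0 mul1r.
Qed.

End LocallyFinite.

(** * Quadratic operators *)

Section Quadratic.
Context {K : numFieldType}.
Local Notation W := (W K).
Local Notation h := (@hmode K).
Local Notation phi := (@phimode K).
Implicit Types (w : W) (P Q : {poly K}) (n r k a b : int).

(** Normal ordering subtracts a scalar, so it does not affect commutators. *)
Lemma nohhE a b w :
  nohh a b w = h a (h b w) - (a%:~R *+ ((b < a) && (a + b == 0))) *: w.
Proof.
have -> : nohh a b w = if a <= b then h a (h b w) else h b (h a w).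
  by rewrite hmode.unlock.
rewrite leNgt; case: ltP => /= _; last by rewrite mulr0n scale0r subr0.
by rewrite [h a (h b w)]hh_comm addrK.
Qed.

Lemma nophiphiE a b w :
  nophiphi a b w = phi a (phi b w) - ((b < a) && (a + b + 1 == 0))%:R *: w.
Proof.
have -> : nophiphi a b w = if a <= b then phi a (phi b w) else - phi b (phi a w).
  by rewrite phimode.unlock.
rewrite leNgt; case: ltP => /= _; last by rewrite scale0r subr0.
by rewrite [phi a (phi b w)]phiphi_comm addrK.
Qed.

Lemma nohhC a b w : nohh a b w = nohh b a w.
Proof. by rewrite /nohh; case: (ltgtP a b) => // ->. Qed.

Lemma nophiphiC a b w : nophiphi a b w = - nophiphi b a w.
Proof.
rewrite /nophiphi; case: (ltgtP a b) => [_|_|->]; rewrite ?opprK //.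
have -> : Defs.phi K b (Defs.phi K b w) = phi b (phi b w) by rewrite phimode.unlock.
by rewrite phi_sqr oppr0.
Qed.

Lemma nohh_linear a b : linear (nohh a b : W -> W).
Proof.
move=> c x y; have := linear_addZ (- (a%:~R *+ ((b < a) && (a + b == 0))))
  (W_comp_linear (h a) (h b)) c x y.
by rewrite !scaleNr -!nohhE.
Qed.

Lemma nophiphi_linear a b : linear (nophiphi a b : W -> W).
Proof.
move=> c x y; have := linear_addZ (- ((b < a) && (a + b + 1 == 0))%:R)
  (W_comp_linear (phi a) (phi b)) c x y.
by rewrite !scaleNr -!nophiphiE.
Qed.

Lemma scale_if (V : lmodType K) (b : bool) (c : K) (x : V) :
  (c *+ b) *: x = if b then c *: x else 0.
Proof. by case: b; rewrite ?mulr1n ?mulr0n ?scale0r. Qed.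

Lemma addr_rev3 (V : zmodType) (x y z : V) : x + (y + z) = z + (y + x).
Proof. by rewrite addrA addrC [x + y]addrC. Qed.

Lemma nohh_h a b r w : nohh a b (h r w) = h r (nohh a b w) +
  ((if b == - r then b%:~R *: h a w else 0) + (if a == - r then a%:~R *: h b w else 0)).
Proof.
rewrite !nohhE hB hZ [h b (h r w)]hh_comm hD [h a (_ *: _)]hZ.
rewrite [h a (h r _)]hh_comm -!scale_if !addr_eq0 -!addrA; congr (_ + _).
exact: addr_rev3.
Qed.

Lemma nohh_phi a b r w : nohh a b (phi r w) = phi r (nohh a b w).
Proof. by rewrite !nohhE phiB -!phi_h phiZ. Qed.

Lemma nophiphi_h a b r w : nophiphi a b (h r w) = h r (nophiphi a b w).
Proof. by rewrite !nophiphiE hB !phi_h hZ. Qed.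

Lemma nophiphi_phi a b r w : nophiphi a b (phi r w) = phi r (nophiphi a b w) +
  ((if b == - r - 1 then phi a w else 0) - (if a == - r - 1 then phi b w else 0)).
Proof.
have e x : (x == - r - 1) = (x + r + 1 == 0) by apply/eqP/eqP; lia.
rewrite !nophiphiE phiB phiZ [phi b (phi r w)]phiphi_comm.
rewrite phiD phiN [phi a (_ *: _)]phiZ.
rewrite [phi a (phi r _)]phiphi_comm !e.
have sc (c : bool) x : c%:R *: x = if c then x else 0 :> W.
  by case: c; rewrite ?scale1r ?scale0r.
rewrite !sc opprD opprK -!addrA; congr (_ + _).
exact: addr_rev3.
Qed.

(** The families of :h(n-k)h(k):, :phi(n-k)phi(k): and phi(n+1/2-k)h(k), where k is
    the exponent of the second factor and the weight is P(D) at D = - k. *)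
Definition famH n P k w : W := P.[- k%:~R] *: nohh (n - k) k w.
Definition famF n P k w : W := P.[- Defs.half K k] *: nophiphi (n - 1 - k) k w.
Definition famM n P k w : W := P.[- k%:~R] *: phi (n - k) (h k w).
Definition opH n P := lfop (`|n|%N + 1) (famH n P).
Definition opF n P := lfop (`|n|%N + 1) (famF n P).
Definition opM n P := lfop (`|n|%N + 1) (famM n P).

Lemma lfsum_opH n P : is_lfsum (famH n P) (opH n P).
Proof.
apply: lfsum_lfop => [k|m S k lt]; first exact/linear_scale/nohh_linear.
rewrite /famH; case: (leP (n - k) k) => le.
  rewrite nohhE (_ : (k < n - k) = false) ?mulr0n ?scale0r ?subr0; last by lia.
  by rewrite [h k _]h_high ?h_vec0 ?scaler0 //; lia.
rewrite nohhC nohhE (_ : (n - k < k) = false) ?mulr0n ?scale0r ?subr0; last by lia.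
by rewrite [h (n - k) _]h_high ?h_vec0 ?scaler0 //; lia.
Qed.

Lemma lfsum_opF n P : is_lfsum (famF n P) (opF n P).
Proof.
apply: lfsum_lfop => [k|m S k lt]; first exact/linear_scale/nophiphi_linear.
rewrite /famF; case: (leP (n - 1 - k) k) => le.
  rewrite nophiphiE (_ : (k < n - 1 - k) = false) ?scale0r ?subr0; last by lia.
  by rewrite [phi k _]phi_high ?phi_vec0 ?scaler0 //; lia.
rewrite nophiphiC nophiphiE (_ : (n - 1 - k < k) = false) ?scale0r ?subr0; last by lia.
by rewrite [phi (n - 1 - k) _]phi_high ?phi_vec0 ?oppr0 ?scaler0 //; lia.
Qed.

Lemma lfsum_opM n P : is_lfsum (famM n P) (opM n P).
Proof.
apply: lfsum_lfop => [k|m S k lt].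
  by apply: linear_scale => c x y; rewrite !linearP.
rewrite /famM; case: (leP 0 k) => le.
  by rewrite [h k _]h_high ?phi_vec0 ?scaler0 //; lia.
by rewrite phi_h [phi (n - k) _]phi_high ?h_vec0 ?scaler0 //; lia.
Qed.

Lemma fl_eval e P (z : K) : (P \Po fl K e).[- z] = P.[z - e%:~R / 2].
Proof. by rewrite horner_comp /fl !hornerE opprK. Qed.

Lemma double_half n : (n *+ 2)%:~R / 2 = n%:~R :> K.
Proof. by rewrite mulr2n intrD; field. Qed.

(** Exchanging the two factors replaces the exponent k by n - k, that is, the
    polynomial P(D) by P(- D - n). *)
Lemma opH_fl n P w : opH n (P \Po fl K (n *+ 2)) w = opH n P w.
Proof.
apply: (lfsum_unique (T' := opH n P) (lfsum_opH _ _)).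
apply: (lfsum_ext _ (frefl _) (lfsum_reflect n (lfsum_opH n P))) => k {}w.
rewrite /famH fl_eval double_half (_ : n - (n - k) = k); last by lia.
by rewrite nohhC intrB opprB.
Qed.

Lemma opF_fl n P w : opF n (P \Po fl K (n *+ 2)) w = - opF n P w.
Proof.
rewrite -scaleN1r.
apply: (lfsum_unique (T' := fun w => -1 *: opF n P w) (lfsum_opF _ _)).
apply: (lfsum_ext _ (frefl _) (lfsumZ (-1) (lfsum_reflect (n - 1) (lfsum_opF n P)))) => k {}w.
rewrite /famF fl_eval double_half (_ : n - 1 - (n - 1 - k) = k); last by lia.
rewrite nophiphiC scalerN scaleN1r opprK; congr (_.[_] *: _).
by rewrite /Defs.half !intrB; field.
Qed.

(** Only the pairs containing h(-r), those with k = - r and k = n + r, contribute to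
    the commutator with h(r). *)
Lemma opH_h n P r w : opH n P (h r w) = h r (opH n P w) -
  (r%:~R * (P.[r%:~R] + P.[- (n + r)%:~R])) *: h (n + r) w.
Proof.
have single k c := lfsum_single k (fun w => (- (r%:~R * c)) *: h (n + r) w).
have rhs := lfsumD (lfsum_post (hmode_linear r) (lfsum_opH n P))
  (lfsumD (single (- r) P.[r%:~R]) (single (n + r) P.[- (n + r)%:~R])).
apply: (lfsum_unique (T' := fun w => h r (opH n P w) - _ *: h (n + r) w)
  (lfsum_pre (h r) (lfsum_opH n P))).
apply: lfsum_ext rhs => [k {}w|{}w]; last first.
  by congr (_ + _); rewrite -scalerDl -opprD -mulrDr scaleNr.
rewrite /famH nohh_h scalerDr hZ; congr (_ + _); rewrite scalerDr; congr (_ + _).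
  case: eqP => [->|_]; last by rewrite scaler0.
  by rewrite intrN opprK opprK scalerA mulrN mulrC.
have -> : (n - k == - r) = (k == n + r) by apply/eqP/eqP; lia.
case: eqP => [->|_]; last by rewrite scaler0.
rewrite (_ : n - (n + r) = - r); last by lia.
by rewrite scalerA intrN mulrN mulrC.
Qed.

Lemma opH_phi n P r w : opH n P (phi r w) = phi r (opH n P w).
Proof.
apply: (lfsum_unique (T' := fun w => phi r (opH n P w))
  (lfsum_pre (phi r) (lfsum_opH n P))).
apply: lfsum_ext (lfsum_post (phimode_linear r) (lfsum_opH n P)) => // k {}w.
by rewrite /famH nohh_phi phiZ.
Qed.

Lemma opF_h n P r w : opF n P (h r w) = h r (opF n P w).
Proof.
apply: (lfsum_unique (T' := fun w => h r (opF n P w))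
  (lfsum_pre (h r) (lfsum_opF n P))).
apply: lfsum_ext (lfsum_post (hmode_linear r) (lfsum_opF n P)) => // k {}w.
by rewrite /famF nophiphi_h hZ.
Qed.

Lemma opF_phi n P r w : opF n P (phi r w) = phi r (opF n P w) +
  (P.[Defs.half K r] - P.[- Defs.half K (n + r)]) *: phi (n + r) w.
Proof.
have single k c := lfsum_single k (fun w => c *: phi (n + r) w).
have rhs := lfsumD (lfsum_post (phimode_linear r) (lfsum_opF n P))
  (lfsumD (single (- r - 1) P.[Defs.half K r]) (single (n + r) (- P.[- Defs.half K (n + r)]))).
apply: (lfsum_unique (T' := fun w => phi r (opF n P w) + _ *: phi (n + r) w)
  (lfsum_pre (phi r) (lfsum_opF n P))).
apply: lfsum_ext rhs => [k {}w|{}w]; last by rewrite scalerDl.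
rewrite /famF nophiphi_phi scalerDr phiZ; congr (_ + _).
rewrite scalerDr; congr (_ + _).
  case: eqP => [->|_]; last by rewrite scaler0.
  rewrite (_ : n - 1 - (- r - 1) = n + r); last by lia.
  by congr (_.[_] *: _); rewrite /Defs.half intrB intrN; field.
have -> : (n - 1 - k == - r - 1) = (k == n + r) by apply/eqP/eqP; lia.
by case: eqP => [->|_]; rewrite ?oppr0 ?scaler0 // scalerN scaleNr.
Qed.

Lemma opM_h n P r w : opM n P (h r w) = h r (opM n P w) -
  (r%:~R * P.[r%:~R]) *: phi (n + r) w.
Proof.
have rhs := lfsumD (lfsum_post (hmode_linear r) (lfsum_opM n P))
  (lfsum_single (- r) (fun w => - ((r%:~R * P.[r%:~R]) *: phi (n + r) w))).
apply: (lfsum_unique (T' := fun w => h r (opM n P w) - _ *: phi (n + r) w)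
  (lfsum_pre (h r) (lfsum_opM n P))).
apply: lfsum_ext rhs => // k {}w.
rewrite /famM [h k (h r w)]hh_comm phiD phiZ scalerDr hZ -phi_h; congr (_ + _).
rewrite addr_eq0; case: eqP => [->|_]; last by rewrite mulr0n scale0r scaler0.
by rewrite mulr1n intrN opprK opprK scalerA mulrN scaleNr mulrC.
Qed.

Lemma opM_phi n P r w : opM n P (phi r w) = - phi r (opM n P w) +
  P.[- (n + r + 1)%:~R] *: h (n + r + 1) w.
Proof.
have rhs := lfsumD (lfsum_post (linear_opp (phimode_linear r)) (lfsum_opM n P))
  (lfsum_single (n + r + 1) (fun w => P.[- (n + r + 1)%:~R] *: h (n + r + 1) w)).
apply: (lfsum_unique (T' := fun w => - phi r (opM n P w) + _ *: h (n + r + 1) w)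
  (lfsum_pre (phi r) (lfsum_opM n P))).
apply: lfsum_ext rhs => // k {}w.
rewrite /famM -phi_h phiphi_comm scalerDr phiZ scalerN; congr (_ + _).
have -> : (n - k + r + 1 == 0) = (k == n + r + 1) by apply/eqP/eqP; lia.
by case: eqP => [->|_]; rewrite ?scale1r // scale0r scaler0.
Qed.

End Quadratic.

(** * The natural action on functions of t and theta *)

Section SuperFunctions.
Context {K : numFieldType}.

(** (e, r) stands for t^(e/2) theta^r, with the exponent of t doubled as in [doidx]. *)
Definition sfidx : choiceType := (int * bool)%type.
Definition sfun := {malg K[sfidx]}.
HB.instance Definition _ := GRing.Lmodule.on sfun.
(** D^l acts on t^(x/2) by (x/2)^l; E_c sends theta^r to theta^(c.1) if r = c.2, and
    to 0 otherwise. *)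
Definition act_basis (i : doidx) (j : sfidx) : sfun :=
  let: (e, l, c) := i in
  if c.2 == j.2 then (j.1%:~R / 2) ^+ l *: << ((e + j.1, c.1) : sfidx) >> else 0.

End SuperFunctions.
Arguments sfun K : clear implicits.

HB.lock Definition sfmono (K : numFieldType) (x : int) (r : bool) : sfun K :=
  << ((x, r) : sfidx) >>.
HB.lock Definition act (K : numFieldType) (a : diffop K) (u : sfun K) : sfun K :=
  linext (fun i => linext (act_basis i) u) a.

Section Action.
Context {K : numFieldType}.
Local Notation act := (@act K).
Local Notation sfmono := (@sfmono K).
Implicit Types (a b : diffop K) (u : sfun K) (P Q : {poly K}) (x e : int) (r : bool).

Lemma act_linearl u : linear (act^~ u).
Proof. by rewrite act.unlock => c a b; rewrite linearP. Qed.

Lemma act_linearr a : linear (act a).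
Proof.
rewrite act.unlock => c u u'; rewrite -linextZf -linextDf /linext.
by apply: eq_bigr => i _; congr (_ *: _); exact: (linearP (linext _)).
Qed.

Lemma sfun_ext (V : lmodType K) (f g : sfun K -> V) : linear f -> linear g ->
  (forall x r, f (sfmono x r) = g (sfmono x r)) -> f =1 g.
Proof.
rewrite sfmono.unlock => lf lg H u.
by apply: malg_linear_ext => // -[x r] _; apply: H.
Qed.

Lemma diffop_ext (V : lmodType K) (f g : diffop K -> V) : linear f -> linear g ->
  (forall e P c, f (tD e c P) = g (tD e c P)) -> f =1 g.
Proof.
move=> lf lg H a; apply: malg_linear_ext => // -[[e l] c] _.
by rewrite -[<< _ >>]/(mono K e l c) -tDXn; apply: H.
Qed.

Lemma act_tD e c P x r : act (tD e c P) (sfmono x r) =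
  if c.2 == r then P.[x%:~R / 2] *: sfmono (e + x) c.1 else 0.
Proof.
move: P; apply: poly_linear_ext => [z P Q|z P Q|l].
- by rewrite [tD _ _ _]linearP act_linearl.
- by case: ifP => _; rewrite ?scaler0 ?addr0 // hornerD hornerZ scalerDl scalerA.
rewrite tDXn /mono act.unlock sfmono.unlock !linextU /act_basis /=.
by rewrite hornerXn.
Qed.

Lemma act_mul a b u : act (a * b) u = act a (act b u).
Proof.
move: u; apply: sfun_ext => [||x r]; first exact: act_linearr.
  by move=> z u u'; rewrite !act_linearr.
move: a; apply: diffop_ext => [z a a'|z a a'|e P c].
- by rewrite mulrDl -scalerAl act_linearl.
- by rewrite act_linearl.
move: b; apply: diffop_ext => [z b b'|z b b'|f Q d].
- by rewrite mulrDr -scalerAr act_linearl.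
- by rewrite act_linearl act_linearr.
have act0 a : act a 0 = 0 := lin0 (act_linearr a).
have act0l u : act 0 u = 0 := lin0 (act_linearl u).
have actZ a z u : act a (z *: u) = z *: act a u := linZ (act_linearr a) z u.
rewrite tDM' [act (tD f d Q) _]act_tD; case: ifP => cd; case: ifP => dr;
  rewrite ?act0l ?act0 ?actZ ?act_tD /= ?dr ?cd ?scaler0 //.
rewrite scalerA addrA hornerM horner_comp mulrC; congr ((_ * _.[_]) *: _).
by rewrite /sh !hornerE intrD mulrDl addrC.
Qed.

Definition sfhomog r u : bool := all (fun j : sfidx => j.2 == r) (msupp u).

End Action.

(** * Parity *)

Section Support.
Context {K : numFieldType} {B : choiceType}.
Implicit Types (Q : pred B) (x y : {malg K[B]}).

Lemma supp_allP Q x : reflect (forall k, x@_k != 0 -> Q k) (all Q (msupp x)).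
Proof.
by apply: (iffP allP) => H k; [rewrite mcoeff_neq0 | rewrite -mcoeff_neq0]; apply: H.
Qed.

Lemma supp_all0 Q : all Q (msupp (0 : {malg K[B]})).
Proof. by apply/supp_allP => k; rewrite mcoeff0 eqxx. Qed.

Lemma supp_all_lin Q c x y : all Q (msupp x) -> all Q (msupp y) ->
  all Q (msupp (c *: x + y)).
Proof.
move=> /supp_allP Qx /supp_allP Qy; apply/supp_allP => k; rewrite mcoeffD mcoeffZ.
by have [->|/Qx//] := eqVneq x@_k 0; rewrite mulr0 add0r; apply: Qy.
Qed.

Lemma supp_all_basis Q k : Q k -> all Q (msupp (<< k >> : {malg K[B]})).
Proof.
move=> Qk; apply/supp_allP => l; rewrite mcoeffU.
by case: (k =P l) => [<-//|_]; rewrite mulr0n eqxx.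
Qed.

Lemma supp_all_sum Q (I : Type) (l : seq I) (F : I -> {malg K[B]}) :
  (forall i, all Q (msupp (F i))) -> all Q (msupp (\sum_(i <- l) F i)).
Proof.
move=> QF; elim/big_rec: _ => [|i x _ Qx]; first exact: supp_all0.
by rewrite -[F i]scale1r; apply: supp_all_lin.
Qed.
End Support.

Section Parity.
Context {K : numFieldType}.
Local Notation W := (W K).
Local Notation h := (@hmode K).
Local Notation phi := (@phimode K).
Implicit Types (w : W) (P : {poly K}) (n r k : int) (p q : bool) (a b : diffop K).

Lemma WhomogZ q c w : Whomog q w -> Whomog q (c *: w).
Proof. by move=> qw; rewrite -[_ *: _]addr0; apply: supp_all_lin => //; apply: supp_all0. Qed.

Lemma WhomogN q w : Whomog q w -> Whomog q (- w).
Proof. by rewrite -scaleN1r; apply: WhomogZ. Qed.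

Lemma WhomogD q w w' : Whomog q w -> Whomog q w' -> Whomog q (w + w').
Proof. by rewrite -[w]scale1r => qw; apply: supp_all_lin; rewrite scale1r in qw. Qed.

Lemma Whomog_wbas m S : Whomog (odd #|` S|) (wbas K m S).
Proof. by rewrite wbas.unlock; apply: supp_all_basis => /=. Qed.

Lemma Whomog_op p (T : W -> W) : linear T ->
  (forall m S, Whomog (p (+) odd #|` S|) (T (wbas K m S))) ->
  forall q w, Whomog q w -> Whomog (p (+) q) (T w).
Proof.
move=> lT HT q w /allP qw; rewrite [w]W_basE linear_sumZ // big_seq.
apply: (big_ind (Whomog (p (+) q))); first exact: supp_all0.
  by move=> x y qx qy; rewrite -[x]scale1r; apply: supp_all_lin.
by move=> b bw; apply: WhomogZ; rewrite -(eqP (qw _ bw)); apply: HT.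
Qed.

Lemma Whomog_h n q w : Whomog q w -> Whomog q (h n w).
Proof.
apply: (Whomog_op (p := false)); first exact: hmode_linear.
move=> m S; case: n => [[|i]|i]; rewrite ?h0 ?h_ann ?h_cre; first exact: supp_all0.
  exact/WhomogZ/Whomog_wbas.
exact: Whomog_wbas.
Qed.

Lemma Whomog_phi r q w : Whomog q w -> Whomog (~~ q) (phi r w).
Proof.
apply: (Whomog_op (p := true)); first exact: phimode_linear.
move=> m S; rewrite phiE; case: ifP => _; last exact: supp_all0.
apply: WhomogZ; suff -> : true (+) odd #|` S| = odd #|` flip (site r) S|.
  exact: Whomog_wbas.
rewrite /flip; case: ifP => iS; last by rewrite cardfsU1 iS.
by rewrite (cardfsD1 (site r) S) iS oddD /=; case: (odd _).
Qed.

Lemma Whomog_lfsum (F : int -> W -> W) (T : W -> W) q w : is_lfsum F T ->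
  (forall k, Whomog q (F k w)) -> Whomog q (T w).
Proof. by move=> FT qF; have [s _ ->] := FT w; apply: supp_all_sum. Qed.

Lemma Whomog_opH n P q w : Whomog q w -> Whomog q (opH n P w).
Proof.
move=> qw; apply: Whomog_lfsum (lfsum_opH n P) _ => k; apply: WhomogZ.
rewrite nohhE addrC -scaleNr; apply: supp_all_lin => //.
exact/Whomog_h/Whomog_h.
Qed.

Lemma Whomog_opF n P q w : Whomog q w -> Whomog q (opF n P w).
Proof.
move=> qw; apply: Whomog_lfsum (lfsum_opF n P) _ => k; apply: WhomogZ.
rewrite nophiphiE addrC -scaleNr; apply: supp_all_lin => //.
by rewrite -[q]negbK; apply/Whomog_phi/Whomog_phi.
Qed.

Lemma Whomog_opM n P q w : Whomog q w -> Whomog (~~ q) (opM n P w).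
Proof.
move=> qw; apply: Whomog_lfsum (lfsum_opM n P) _ => k; apply: WhomogZ.
exact/Whomog_phi/Whomog_h.
Qed.

Lemma homog_mul p q a b : homog p a -> homog q b -> homog (p (+) q) (a * b).
Proof.
move=> /allP pa /allP qb; rewrite -[_ * _]/(dmul a b) /dmul.
apply: (linext_all (P := homog (p (+) q))) => [|c x y|i ia];
  [exact: supp_all0|exact: supp_all_lin|].
apply: (linext_all (P := homog (p (+) q))) => [|c x y|j jb];
  [exact: supp_all0|exact: supp_all_lin|].
rewrite -(eqP (pa _ ia)) -(eqP (qb _ jb)).
case: i j {ia jb pa qb} => [[e l] [c1 c2]] [[f m] [d1 d2]]; rewrite /bmul /ipar /=.
case: eqP => [<-|_]; last exact: supp_all0.
have -> : (c1 (+) c2) (+) (c2 (+) d2) = c1 (+) d2 by case: c1 c2 d2 => [] [] [].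
exact: (homog_tD (c1, d2)).
Qed.

Lemma homog_lin p c a b : homog p a -> homog p b -> homog p (c *: a + b).
Proof. exact: supp_all_lin. Qed.

Lemma homog_sbr p q a b : homog p a -> homog q b -> homog (p (+) q) (sbr a b).
Proof.
move=> pa qb; rewrite (sbr_homog pa qb) addrC -scaleNr; apply: homog_lin.
  by rewrite addbC; apply: homog_mul.
exact: homog_mul.
Qed.

Lemma sfhomog_act p a (x : int) (r : bool) :
  homog p a -> sfhomog (p (+) r) (act a (sfmono K x r)).
Proof.
move=> /allP pa; rewrite act.unlock sfmono.unlock.
apply: (linext_all (P := sfhomog (p (+) r))) => [|c u u'|i ia];
  [exact: supp_all0|exact: supp_all_lin|].
rewrite linextU -(eqP (pa _ ia)) {ia pa}; case: i => [[e l] [c1 c2]].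
rewrite /act_basis /ipar /=; case: eqP => [->|_]; last exact: supp_all0.
rewrite -[_ *: _]addr0; apply: supp_all_lin; last exact: supp_all0.
by apply: supp_all_basis => /=; rewrite -addbA addbb addbF.
Qed.

End Parity.

(** * Commutators of quadratic operators with modes *)

(** The mode attached to a function.  It vanishes on t^(x/2) theta^r unless x/2 is
    integral for r = 0 and half-integral for r = 1; SD_NS preserves this
    condition.  The sign and the weight on odd functions are forced: if a is the sum of
    t^(e/2) P(D) D theta and of its image under gamma, then a t^m is
    m P(m) t^(e/2 + m) theta, while [psi(a), h(m)] = - s m P(m) phi(e/2 + m). *)
HB.lock Definition mode (K : numFieldType) (s : K) (u : sfun K) (w : W K) : W K :=
  linext (fun j : sfidx =>
    if odd `|j.1|%N == j.2 then
      if j.2 then - s *: phimode (j.1 %/ 2)%Z w else hmode (j.1 %/ 2)%Z w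
    else 0) u.

(** The quadratic operator of gen c e P.  The series are summed over ordered pairs and
    a gamma-fixed element has both a theta and a d/dtheta component, hence the
    factors 1/2: the operator depends on gen c e P through its symmetrization
    under gamma only. *)
Definition quad_op (K : numFieldType) (s : K) (c : bool * bool) (e : int) (P : {poly K}) :
    W K -> W K :=
  let n := (e %/ 2)%Z in
  match c with
  | (false, false) => fun w => (s ^+ 2 / 2) *: opH n P w
  | (true, true) => fun w => 2^-1 *: opF n P w
  | (true, false) => fun w => (s / 2) *: opM n P w
  | (false, true) => fun w => (s / 2) *: opM n (P \Po fl K e) w
  end.

(** The extension of psi to all differential operators.  The exponent of D is lowered
    by one when E_c comes with the extra factor D, so that 'X^l is the polynomial
    P of gen c e P. *)
HB.lock Definition psi_ext (K : numFieldType) (s : K) (a : diffop K) (w : W K) : W K :=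
  linext (fun i : doidx =>
    quad_op s i.2 i.1.1 'X^(i.1.2 - ~~ i.2.2) w) a.

Section Representation.
Context {K : numFieldType} (s : K) (s2 : s ^+ 2 = -1).
Local Notation W := (W K).
Local Notation h := (@hmode K).
Local Notation phi := (@phimode K).
Local Notation v := (@mode K s).
Local Notation psi_ext := (@psi_ext K s).
Local Notation quad_op := (@quad_op K s).
Local Notation act := (@act K).
Local Notation sfmono := (@sfmono K).
Local Notation half := (Defs.half K).
Implicit Types (w : W) (P Q : {poly K}) (n y e : int) (p q r : bool) (a b : diffop K).
Implicit Types (u : sfun K) (c : bool * bool).

Lemma opH_linearP n w : linear (fun P => opH n P w).
Proof.
move=> z P Q; have rhs := lfsumD (lfsumZ z (lfsum_opH n P)) (lfsum_opH n Q).
apply: (lfsum_unique (lfsum_opH n _) (lfsum_ext _ (frefl _) rhs)) => k {}w.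
by rewrite /famH scalerA -scalerDl hornerD hornerZ.
Qed.

Lemma opF_linearP n w : linear (fun P => opF n P w).
Proof.
move=> z P Q; have rhs := lfsumD (lfsumZ z (lfsum_opF n P)) (lfsum_opF n Q).
apply: (lfsum_unique (lfsum_opF n _) (lfsum_ext _ (frefl _) rhs)) => k {}w.
by rewrite /famF scalerA -scalerDl hornerD hornerZ.
Qed.

Lemma opM_linearP n w : linear (fun P => opM n P w).
Proof.
move=> z P Q; have rhs := lfsumD (lfsumZ z (lfsum_opM n P)) (lfsum_opM n Q).
apply: (lfsum_unique (lfsum_opM n _) (lfsum_ext _ (frefl _) rhs)) => k {}w.
by rewrite /famM scalerA -scalerDl hornerD hornerZ.
Qed.

Lemma quad_linearP c e w : linear (fun P => quad_op c e P w).
Proof.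
case: c => [[] []] /=; apply: linear_scale.
- exact: opF_linearP.
- exact: opM_linearP.
- by move=> z P Q; rewrite comp_polyD comp_polyZ opM_linearP.
- exact: opH_linearP.
Qed.

Lemma quad_linear c e P : linear (quad_op c e P).
Proof.
by case: c => [[] []] /=; apply/linear_scale/lfop_linear.
Qed.

Lemma psi_ext_linearl w : linear (psi_ext^~ w).
Proof. by rewrite psi_ext.unlock => z a b; rewrite linearP. Qed.

Lemma psi_ext_linear a : linear (psi_ext a).
Proof.
rewrite psi_ext.unlock => z w w'; rewrite -linextZf -linextDf /linext.
by apply: eq_bigr => i _; congr (_ *: _); apply: quad_linear.
Qed.

Lemma psi_ext_gen c e P w : psi_ext (gen c e P) w = quad_op c e P w.
Proof.
move: P; apply: poly_linear_ext => [z P Q|z P Q|l].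
- by rewrite [gen _ _ _]linearP psi_ext_linearl.
- exact: quad_linearP.
by rewrite genXn /mono psi_ext.unlock linextU /= addnK.
Qed.

Lemma psi_extZ a z w : psi_ext a (z *: w) = z *: psi_ext a w.
Proof. exact: (linZ (psi_ext_linear a)). Qed.
Lemma psi_ext0 a : psi_ext a 0 = 0.
Proof. exact: (lin0 (psi_ext_linear a)). Qed.

Lemma mode_linearl w : linear (v^~ w).
Proof. by rewrite mode.unlock => z a b; rewrite linearP. Qed.

Lemma mode_linear u : linear (v u).
Proof.
rewrite mode.unlock => z w w'; rewrite -linextZf -linextDf /linext.
apply: eq_bigr => i _; congr (_ *: _).
case: ifP => _; last by rewrite scaler0 addr0.
case: ifP => _; last exact: hmode_linear.
exact/(linear_scale (- s))/phimode_linear.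
Qed.

Lemma mode_mono x r w : v (sfmono x r) w =
  if odd `|x|%N == r then
    if r then - s *: phi (x %/ 2)%Z w else h (x %/ 2)%Z w
  else 0.
Proof. by rewrite mode.unlock sfmono.unlock linextU. Qed.

Lemma mode_h n w : v (sfmono (n *+ 2) false) w = h n w.
Proof.
rewrite mode_mono (_ : odd _ = false) /=; last by lia.
by rewrite (_ : (n *+ 2 %/ 2)%Z = n); last by lia.
Qed.

Lemma mode_phi n w : v (sfmono (n *+ 2 + 1) true) w = - s *: phi n w.
Proof.
rewrite mode_mono (_ : odd _ = true) /=; last by lia.
by rewrite (_ : ((n *+ 2 + 1) %/ 2)%Z = n); last by lia.
Qed.

Lemma mode_off x r w : odd `|x|%N != r -> v (sfmono x r) w = 0.
Proof. by rewrite mode_mono => /negbTE ->. Qed.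

Lemma double_half1 n : (n *+ 2 + 1)%:~R / 2 = half n.
Proof. by rewrite /Defs.half mulr2n !intrD; field. Qed.

Lemma act_gen c e P x r : act (gen c e P) (sfmono x r) =
  if c.2 == r then (P.[x%:~R / 2] * (xf K c.2).[x%:~R / 2]) *: sfmono (e + x) c.1 else 0.
Proof. by rewrite /gen act_tD hornerM. Qed.

Lemma fl_fl e : fl K e \Po fl K e = 'X.
Proof.
have -> : fl K e \Po fl K e = - fl K e - (e%:~R / 2)%:P.
  rewrite {2}/fl comp_polyB comp_polyC; congr (_ - _).
  by rewrite -['X in LHS]scale1r -scaleNr comp_polyZ comp_polyX scaleN1r.
by rewrite /fl opprB opprK addrAC subrr add0r.
Qed.

Lemma gamma_fl e r P : gamma (gen (r, ~~ r) e P) = gen (~~ r, r) e (P \Po fl K e).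
Proof. by rewrite gammaE /=; case: r; rewrite expr0 scale1r. Qed.

Lemma modeZ z u w : v (z *: u) w = z *: v u w.
Proof. exact: (linZ (mode_linearl w)). Qed.
Lemma mode0 w : v 0 w = 0.
Proof. exact: (lin0 (mode_linearl w)). Qed.
Lemma modeD u u' w : v (u + u') w = v u w + v u' w.
Proof. exact: (linD (mode_linearl w)). Qed.
Lemma actD a b u : act (a + b) u = act a u + act b u.
Proof. exact: (linD (act_linearl u)). Qed.
Lemma actZ z a u : act (z *: a) u = z *: act a u.
Proof. exact: (linZ (act_linearl u)). Qed.

Lemma fl_horner e P (z : K) : (P \Po fl K e).[z] = P.[- z - e%:~R / 2].
Proof. by rewrite -[z in LHS]opprK fl_eval. Qed.

Lemma opM_psi n P w : psi_ext (gen (true, false) (n *+ 2 + 1) P) w = (s / 2) *: opM n P w.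
Proof. by rewrite psi_ext_gen /= (_ : ((n *+ 2 + 1) %/ 2)%Z = n) //; lia. Qed.

(** gamma exchanges the theta and d/dtheta components, so that the latter need not be
    computed separately. *)
Lemma psi_ext_gen_fl e P w :
  psi_ext (gen (false, true) e P) w = psi_ext (gen (true, false) e (P \Po fl K e)) w.
Proof. by rewrite !psi_ext_gen. Qed.

Lemma sym_gen_fl e P : gen (false, true) e P + gamma (gen (false, true) e P) =
  gen (true, false) e (P \Po fl K e) + gamma (gen (true, false) e (P \Po fl K e)).
Proof. by rewrite (gamma_fl e false) (gamma_fl e true) /= -comp_polyA fl_fl comp_polyXr addrC. Qed.

Lemma s_neq0 : s != 0.
Proof.
by apply: contra_eq_neq s2 => ->; rewrite expr0n /= eq_sym oppr_eq0 oner_eq0.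
Qed.

(** In the next four lemmas the factor 2^-1 averages x and gamma(x), which produce the
    two terms of the commutator; 2^-1 / s also undoes the - s in the mode of
    t^(y + 1/2) theta. *)
Lemma comm_ff n P y w : psi_ext (gen (false, false) (n *+ 2) P) (h y w) =
  h y (psi_ext (gen (false, false) (n *+ 2) P) w) +
  2^-1 *: v (act (gen (false, false) (n *+ 2) P +
    gamma (gen (false, false) (n *+ 2) P)) (sfmono (y *+ 2) false)) w.
Proof.
rewrite gammaE expr0 scale1r actD !act_gen /= modeD !modeZ -mulrnDl mode_h.
rewrite !psi_ext_gen /= (_ : (n *+ 2 %/ 2)%Z = n); last by lia.
rewrite opH_h scalerBr hZ; congr (_ + _).
rewrite -scalerDl !scalerA -scaleNr; congr (_ *: _).
rewrite s2 !hornerX fl_horner !double_half intrD -opprD [y%:~R + _]addrC.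
by field.
Qed.

Lemma comm_tt n P y w : psi_ext (gen (true, true) (n *+ 2) P) (phi y w) =
  phi y (psi_ext (gen (true, true) (n *+ 2) P) w) -
  (2^-1 / s) *: v (act (gen (true, true) (n *+ 2) P +
    gamma (gen (true, true) (n *+ 2) P)) (sfmono (y *+ 2 + 1) true)) w.
Proof.
have s0 := s_neq0.
rewrite gammaE expr1 scaleN1r actD -scaleN1r actZ !act_gen /= modeD !modeZ addrA -mulrnDl mode_phi.
rewrite !psi_ext_gen /= (_ : (n *+ 2 %/ 2)%Z = n); last by lia.
rewrite opF_phi scalerDr phiZ; congr (_ + _).
rewrite !scalerA -scalerDl !scalerA -scaleNr; congr (_ *: _).
rewrite !hornerC fl_horner double_half1 double_half.
have -> : - half y - n%:~R = - half (n + y) by rewrite /Defs.half intrD; ring.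
by field.
Qed.

Lemma comm_tf_h n P y w : psi_ext (gen (true, false) (n *+ 2 + 1) P) (h y w) =
  h y (psi_ext (gen (true, false) (n *+ 2 + 1) P) w) +
  2^-1 *: v (act (gen (true, false) (n *+ 2 + 1) P +
    gamma (gen (true, false) (n *+ 2 + 1) P)) (sfmono (y *+ 2) false)) w.
Proof.
rewrite (gamma_fl _ true) actD !act_gen /= addr0 modeZ.
rewrite (_ : n *+ 2 + 1 + y *+ 2 = (n + y) *+ 2 + 1) ?mode_phi; last by lia.
rewrite !opM_psi opM_h scalerBr hZ; congr (_ + _).
rewrite !scalerA -scaleNr hornerX double_half; congr (_ *: _).
by field.
Qed.

Lemma comm_tf_phi n P y w : psi_ext (gen (true, false) (n *+ 2 + 1) P) (phi y w) =
  - phi y (psi_ext (gen (true, false) (n *+ 2 + 1) P) w) -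
  (2^-1 / s) *: v (act (gen (true, false) (n *+ 2 + 1) P +
    gamma (gen (true, false) (n *+ 2 + 1) P)) (sfmono (y *+ 2 + 1) true)) w.
Proof.
have s0 := s_neq0.
rewrite (gamma_fl _ true) actD !act_gen /= add0r modeZ.
rewrite (_ : n *+ 2 + 1 + (y *+ 2 + 1) = (n + y + 1) *+ 2) ?mode_h; last by lia.
rewrite !opM_psi opM_phi scalerDr scalerN phiZ; congr (_ + _).
rewrite !scalerA -scaleNr hornerC fl_horner !double_half1; congr (_ *: _).
have -> : - half y - half n = - (n + y + 1)%:~R by rewrite /Defs.half !intrD; field.
have -> : s^-1 = - s by apply: (mulfI s0); rewrite mulfV // mulrN -expr2 s2 opprK.
by rewrite mulr1; field.
Qed.

(** For a generator x of SD_NS the super commutator of its quadratic operator with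
    mode(u) is mode(x' u), where x' = (x + gamma(x)) / 2; it is not mode(x u) because
    exchanging the two factors of a pair identifies x with gamma(x). *)
Lemma psi_ext_gen_mode c e P x r w : odd `|e|%N = c.1 (+) c.2 ->
  psi_ext (gen c e P) (v (sfmono x r) w) =
  (-1) ^+ ((c.1 (+) c.2) && r) *: v (sfmono x r) (psi_ext (gen c e P) w) +
  2^-1 *: v (act (gen c e P + gamma (gen c e P)) (sfmono x r)) w.
Proof.
have s0 := s_neq0.
move=> ec; have [xr|xr] := boolP (odd `|x|%N == r); last first.
  (* Off the lattice both sides vanish, since gen c e P preserves the lattice. *)
  rewrite !mode_off // psi_ext0 scaler0 add0r actD modeD.
  have off d Q : d.1 (+) d.2 = c.1 (+) c.2 -> v (act (gen d e Q) (sfmono x r)) w = 0.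
    move=> dc; rewrite act_gen; case: eqP => [dr|_]; last exact: mode0.
    rewrite modeZ mode_off ?scaler0 // oddzD ec -dc dr.
    by move: xr; case: (odd _) (d.1) r {dr} => [] [] [].
  by rewrite off // gammaE actZ modeZ off ?scaler0 ?addr0 ?scaler0 //= addbC.
have {xr} [y ->] : exists y, x = y *+ 2 + r%:Z.
  by exists (x %/ 2)%Z; move: xr; case: r => /=; lia.
have {ec} [n ->] : exists n, e = n *+ 2 + (c.1 (+) c.2)%:Z.
  by exists (e %/ 2)%Z; move: ec; case: (_ (+) _) => /=; lia.
have diag d r' Q : r' != d -> v (act (gen (d, d) (n *+ 2) Q +
    gamma (gen (d, d) (n *+ 2) Q)) (sfmono (y *+ 2 + r'%:Z) r')) w = 0.
  move=> ne; rewrite gammaE actD actZ !act_gen /= eq_sym (negbTE ne).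
  by rewrite scaler0 addr0 mode0.
have odd_case Q : psi_ext (gen (true, false) (n *+ 2 + 1) Q) (v (sfmono (y *+ 2 + r%:Z) r) w) =
    (-1) ^+ r *: v (sfmono (y *+ 2 + r%:Z) r) (psi_ext (gen (true, false) (n *+ 2 + 1) Q) w) +
    2^-1 *: v (act (gen (true, false) (n *+ 2 + 1) Q +
      gamma (gen (true, false) (n *+ 2 + 1) Q)) (sfmono (y *+ 2 + r%:Z) r)) w.
  case: r {diag} => /=; last by rewrite addr0 expr0 scale1r !mode_h comm_tf_h.
  rewrite expr1 scaleN1r !mode_phi psi_extZ comm_tf_phi scalerBr; congr (_ + _).
    by rewrite scaleNr scalerN opprK scaleNr opprK.
  by rewrite scalerA -scaleNr; congr (_ *: _); field.
case: c => [[] []] /=; last 1 first.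
- rewrite addr0 expr0 scale1r; case: r diag {odd_case} => [/(_ false true) ->//|_] /=.
    rewrite scaler0 addr0 !mode_phi psi_extZ !psi_ext_gen /= (_ : (n *+ 2 %/ 2)%Z = n); last by lia.
    by rewrite opH_phi phiZ.
  by rewrite addr0 !mode_h comm_ff.
- rewrite addr0 expr0 scale1r; case: r diag {odd_case} => [_|/(_ true false) ->//] /=.
    rewrite !mode_phi psi_extZ comm_tt scalerBr; congr (_ + _).
    by rewrite scalerA -scaleNr; congr (_ *: _); field.
  rewrite addr0 scaler0 addr0 !mode_h !psi_ext_gen /= (_ : (n *+ 2 %/ 2)%Z = n); last by lia.
  by rewrite opF_h hZ.
- exact: odd_case.
- by rewrite !psi_ext_gen_fl sym_gen_fl; exact: odd_case.
Qed.

End Representation.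

(** * The projective representation *)

Section Projective.
Context {K : numFieldType} (s : K) (s2 : s ^+ 2 = -1).
Local Notation W := (W K).
Local Notation h := (@hmode K).
Local Notation phi := (@phimode K).
Local Notation v := (@mode K s).
Local Notation psi_ext := (@psi_ext K s).
Local Notation act := (@act K).
Local Notation sfmono := (@sfmono K).
Implicit Types (w : W) (P Q : {poly K}) (n y e x : int) (p q r : bool) (a b : diffop K).
Implicit Types (u : sfun K) (c : bool * bool).

Lemma psi_ext_mode_sym p a x r w : in_SDNS a -> homog p a ->
  psi_ext a (v (sfmono x r) w) = (-1) ^+ (p && r) *: v (sfmono x r) (psi_ext a w) +
    2^-1 *: v (act (a + gamma a) (sfmono x r)) w.
Proof.
move=> /allP Sa /allP pa.
apply: (malg_linear_ext (f := fun a => psi_ext a (v (sfmono x r) w))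
  (g := fun a => (-1) ^+ (p && r) *: v (sfmono x r) (psi_ext a w) +
    2^-1 *: v (act (a + gamma a) (sfmono x r)) w)).
- exact: psi_ext_linearl.
- apply: linear_comb => z b b'; first by rewrite psi_ext_linearl mode_linear.
  rewrite -modeZ -modeD -actZ -actD linearP; congr (v (act _ _) w).
  by rewrite scalerDr addrACA.
move=> k ka; have [c [e [l [ec ek]]]] := SDNS_idxP K (Sa _ ka).
have : homog (c.1 (+) c.2) (<< k >> : diffop K) by rewrite ek; apply: homog_tD.
move=> /allP/(_ k); rewrite -mcoeff_neq0 mcoeffUU oner_eq0 => /(_ isT).
by rewrite (eqP (pa _ ka)) ek => /eqP ->; apply: psi_ext_gen_mode.
Qed.

(** A gamma-fixed a equals its own symmetrization, so psi(a) acts on modes exactly as a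
    acts on functions. *)
Lemma psi_ext_mode p a r u w : in_SDNSplus a -> homog p a -> sfhomog r u ->
  psi_ext a (v u w) = (-1) ^+ (p && r) *: v u (psi_ext a w) + v (act a u) w.
Proof.
move=> /andP[Sa /eqP ga] pa /allP ru.
apply: (malg_linear_ext (f := fun u => psi_ext a (v u w))
  (g := fun u => (-1) ^+ (p && r) *: v u (psi_ext a w) + v (act a u) w)).
- by move=> z u1 u2; rewrite mode_linearl psi_ext_linear.
- move=> z u1 u2; rewrite act_linearr !mode_linearl !scalerDr !scalerA.
  by rewrite [_ * z]mulrC addrACA.
move=> [x r'] xu; have /= /eqP e := ru _ xu.
have -> : << (x, r') >> = sfmono x r' by rewrite sfmono.unlock.
rewrite (psi_ext_mode_sym x r' w Sa pa) ga e; congr (_ + _).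
rewrite -modeZ -actZ; congr (v (act _ _) w).
have half2 : 2^-1 + 2^-1 = 1 :> K by field.
by rewrite scalerDr -scalerDl half2 scale1r.
Qed.

Lemma Whomog_psi_ext p q a w : homog p a -> Whomog q w -> Whomog (p (+) q) (psi_ext a w).
Proof.
move=> /allP pa qw; rewrite psi_ext.unlock.
apply: (linext_all (P := Whomog (p (+) q))) => [|z x y|k ka].
- exact: supp_all0.
- exact: supp_all_lin.
rewrite -(eqP (pa _ ka)) /ipar; case: k.2 => [[] []] /=; apply: WhomogZ.
- exact: Whomog_opF.
- exact: Whomog_opM.
- exact: Whomog_opM.
- exact: Whomog_opH.
Qed.

Definition defect p q a b w : W :=
  psi_ext a (psi_ext b w) - (-1) ^+ (p && q) *: psi_ext b (psi_ext a w) - psi_ext (sbr a b) w.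

Lemma psi_extD a w w' : psi_ext a (w + w') = psi_ext a w + psi_ext a w'.
Proof. exact: (linD (psi_ext_linear s a)). Qed.

Lemma defect_linear p q a b : linear (defect p q a b).
Proof.
move=> z w w'; rewrite /defect !psi_ext_linear; apply/malgP => k.
by rewrite !(mcoeffB, mcoeffD, mcoeffZ); ring.
Qed.

(** The Jacobi identity: moving mode(u) to the left through psi(a) psi(b) and
    psi(b) psi(a) produces the actions of ab and ba on u, which the bracket term
    cancels; the mixed terms cancel each other. *)
Lemma defect_mode p q a b x r w : in_SDNSplus a -> in_SDNSplus b ->
  in_SDNSplus (sbr a b) -> homog p a -> homog q b ->
  defect p q a b (v (sfmono x r) w) =
    (-1) ^+ ((p (+) q) && r) *: v (sfmono x r) (defect p q a b w).
Proof.
move=> Sa Sb Sab pa qb.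
have ru : sfhomog r (sfmono x r).
  by rewrite sfmono.unlock; apply: supp_all_basis => /=.
have vlin := mode_linear s (sfmono x r).
rewrite /defect (psi_ext_mode w Sb qb ru) (psi_ext_mode w Sa pa ru).
rewrite (psi_ext_mode w Sab (homog_sbr pa qb) ru).
rewrite !psi_extD !psi_extZ (psi_ext_mode _ Sa pa ru) (psi_ext_mode _ Sb qb ru).
rewrite (psi_ext_mode w Sa pa (sfhomog_act x r qb)) (psi_ext_mode w Sb qb (sfhomog_act x r pa)).
have -> : act (sbr a b) (sfmono x r) =
    act a (act b (sfmono x r)) - (-1) ^+ (p && q) *: act b (act a (sfmono x r)).
  by rewrite (sbr_homog pa qb) -scaleNr actD actZ scaleNr !act_mul.
rewrite (linB (mode_linearl s w)) modeZ !(linB vlin) (linZ vlin).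
move: (v (sfmono x r) _) (v (sfmono x r) _) (v (sfmono x r) _) => X1 X5 X7.
apply/malgP => k; rewrite !(mcoeffB, mcoeffD, mcoeffZ).
by case: p q r {pa qb ru vlin} => [] [] []; rewrite /= ?expr0 ?expr1; ring.
Qed.

(** Schur's lemma applies to the defect; when a and b have different parities, it sends
    the even vacuum to an odd vector, so its vacuum coefficient is 0. *)
Lemma defect_scalar p q a b : in_SDNSplus a -> in_SDNSplus b ->
  in_SDNSplus (sbr a b) -> homog p a -> homog q b ->
  exists c : K, forall w, defect p q a b w = c *: w.
Proof.
move=> Sa Sb Sab pa qb; have comm := defect_mode _ _ _ Sa Sb Sab pa qb.
apply: (fock_schur (p := p (+) q)); first exact: defect_linear.
- by move=> n w; rewrite -!(mode_h s) comm andbF expr0 scale1r.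
- move=> r w; have := comm (r *+ 2 + 1) true w; rewrite !mode_phi.
  have -> : defect p q a b (- s *: phi r w) = - s *: defect p q a b (phi r w).
    exact: (linZ (defect_linear p q a b)).
  rewrite andbT scalerA [_ * - s]mulrC -scalerA => /scalerI; apply.
  by rewrite oppr_eq0 s_neq0.
move=> pq; have vac_even : Whomog false (vac : W) by apply: (Whomog_wbas (onecm nat) fset0).
have : Whomog (p (+) q) (defect p q a b vac).
  rewrite /defect -!scaleN1r; apply: WhomogD; last first.
    rewrite scaleN1r; apply: WhomogN.
    by have := Whomog_psi_ext (homog_sbr pa qb) vac_even; rewrite addbF.
  apply: WhomogD.
    by have := Whomog_psi_ext pa (Whomog_psi_ext qb vac_even); rewrite addbF.
  apply/WhomogZ/WhomogZ.
  by have := Whomog_psi_ext qb (Whomog_psi_ext pa vac_even); rewrite addbF addbC.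
move=> /supp_allP/(_ (onecm nat, fset0)); rewrite pq cardfs0.
by case: eqP => // _ /(_ isT).
Qed.

(** The symmetrization x + gamma(x) of the basis element x of SD_NS with index k.  Since
    exp(y D) has the coefficient D^m / m! at y^m, it is m! times a coefficient of
    y1^0 y2^m, or of y1^m y2^0 if x is a multiple of d/dtheta; here m is l, less one when
    the generating function contributes its own factor D. *)
Definition sym_gen (k : doidx) : SDNSplus K :=
  let: (e, l, c) := k in
  let n := (e %/ 2)%Z in
  match c with
  | (false, false) => (l.-1)`!%:R *: calD K n 0 l.-1
  | (true, true) => l`!%:R *: calDbar K n 0 l
  | (true, false) => (l.-1)`!%:R *: calG K n 0 l.-1
  | (false, true) => l`!%:R *: calG K n l 0
  end.

Lemma Qp_0r e l : l`!%:R *: Qp K e 0 l = 'X^l.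
Proof.
rewrite /Qp !expr0 expr1n mul1r fact0 invr1 scalerA !mul1r divff ?scale1r //.
by rewrite pnatr_eq0 -lt0n fact_gt0.
Qed.

Lemma Qp_0l e l : l`!%:R *: Qp K e l 0 = 'X^l \Po fl K e.
Proof. by rewrite -Qp_fl -comp_polyZ Qp_0r. Qed.

Lemma scale_gen (z : K) c e P : z *: gen c e P = gen c e (z *: P).
Proof. by rewrite linearZ. Qed.

Lemma SDNSvalZ (z : K) (x : SDNSplus K) : SDNSval (z *: x) = z *: SDNSval x.
Proof. exact: (linearZZ (\val : SDNSplus K -> diffop K)). Qed.

Lemma sym_genE k : SDNS_idx k ->
  SDNSval (sym_gen k) = << k >> + gamma (<< k >> : diffop K).
Proof.
move=> Sk; have [c [e [l [ec ek]]]] := SDNS_idxP K Sk.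
move: ek; rewrite genXn /mono => /malgP/(_ k); rewrite mcoeffUU mcoeffU.
case: eqP => [<- _|_ /eqP]; last by rewrite mulr0n oner_eq0.
have -> : << (e, (l + ~~ c.2)%N, c) >> = gen c e 'X^l :> diffop K by rewrite genXn.
have [n en] : exists n, e = n *+ 2 + (c.1 (+) c.2)%:Z.
  by exists (e %/ 2)%Z; move: ec; case: (_ (+) _) => /=; lia.
rewrite {}en {ec Sk k}; rewrite gammaE.
case: c => [[] []] /=; rewrite ?expr0 ?expr1 ?scale1r ?scaleN1r ?addr0 ?addn0 ?addn1 /=.
- rewrite (_ : (n *+ 2 %/ 2)%Z = n); last by lia.
  by rewrite calDbarE scale_gen scalerBr Qp_0r Qp_0l linearB.
- rewrite (_ : ((n *+ 2 + 1) %/ 2)%Z = n); last by lia.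
  by rewrite GE scalerDr !scale_gen Qp_0r Qp_0l.
- rewrite (_ : ((n *+ 2 + 1) %/ 2)%Z = n); last by lia.
  by rewrite GE scalerDr !scale_gen Qp_0r Qp_0l addrC.
rewrite (_ : (n *+ 2 %/ 2)%Z = n); last by lia.
by rewrite calDE scale_gen scalerDr Qp_0r Qp_0l linearD.
Qed.

(** An element fixed by gamma is the half sum of itself and its image. *)
Lemma SDNSplus_span (a : SDNSplus K) :
  a = 2^-1 *: \sum_(k <- msupp (SDNSval a)) (SDNSval a)@_k *: sym_gen k.
Proof.
apply: val_inj; rewrite -[LHS]/(SDNSval a) -[RHS]/(SDNSval _) SDNSvalZ.
have -> : SDNSval (\sum_(k <- msupp (SDNSval a)) (SDNSval a)@_k *: sym_gen k) =
    \sum_(k <- msupp (SDNSval a)) SDNSval ((SDNSval a)@_k *: sym_gen k).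
  exact: (raddf_sum (\val : {additive SDNSplus K -> diffop K})).
have /andP[/allP Sa /eqP ga] := valP a.
have -> : \sum_(k <- msupp (SDNSval a)) SDNSval ((SDNSval a)@_k *: sym_gen k) =
    SDNSval a + gamma (SDNSval a).
  have sym_linear : linear (fun x : diffop K => x + gamma x).
    by move=> z x y; rewrite linearP scalerDr addrACA.
  rewrite [RHS](_ : _ = (fun x : diffop K => x + gamma x) (\sum_(k <- msupp (SDNSval a))
    (SDNSval a)@_k *: << k >>)); last by rewrite -malgE.
  rewrite (linear_sumZ _ _ _ sym_linear).
  rewrite big_seq [RHS]big_seq; apply: eq_bigr => k ka.
  by rewrite SDNSvalZ sym_genE ?Sa.
rewrite ga.
have half2 : 2^-1 + 2^-1 = 1 :> K by field.
by rewrite scalerDr -scalerDl half2 scale1r.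
Qed.

End Projective.

(** * Generating functions and uniqueness *)

Section Main.
Context {K : numFieldType} (s : K) (s2 : s ^+ 2 = -1).
Local Notation W := (W K).
Implicit Types (w : W) (P : {poly K}) (n k : int) (i j : nat).

HB.instance Definition _ (a : diffop K) :=
  GRing.isLinear.Build K W W *:%R (psi_ext s a) (psi_ext_linear s a).

Definition psi (a : SDNSplus K) : {linear W -> W} := psi_ext s (SDNSval a).

Lemma psi_linear w : linear (fun a : SDNSplus K => psi a w).
Proof. by move=> z a b; rewrite /= -psi_ext_linearl. Qed.

(** The weight of a pair of modes: Qp collects exp(- y1 (D + e/2)) exp(y2 D), and D is
    minus the exponent of the second factor. *)
Lemma Qp_horner e i j (z : K) :
  (Qp K e i j).[z] = ecoef (- (z + e%:~R / 2)) i * ecoef z j.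
Proof.
rewrite /Qp /ecoef /sh hornerZ hornerM !horner_exp hornerD !hornerX hornerC.
rewrite [(- (_ + _)) ^+ i]exprNn.
have -> : (1 : K) ^+ j = 1 by rewrite expr1n.
by move: (_ ^+ i) (_ ^+ i) (_ ^+ j) (i`!%:R^-1) (j`!%:R^-1) => *; ring.
Qed.

Lemma psi_calD n i j w : psi (calD K n i j) w = s ^+ 2 *: opH n (Qp K (n *+ 2) i j) w.
Proof.
rewrite /psi /= calDE psi_ext_gen /= (_ : (n *+ 2 %/ 2)%Z = n); last by lia.
rewrite (linD (opH_linearP n w)) -(Qp_fl K _ i j) opH_fl -mulr2n -scaler_nat scalerA.
by congr (_ *: _); field.
Qed.

Lemma psi_calDbar n i j w : psi (calDbar K n i j) w = opF n (Qp K (n *+ 2) i j) w.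
Proof.
rewrite /psi /= calDbarE psi_ext_gen /= (_ : (n *+ 2 %/ 2)%Z = n); last by lia.
rewrite (linB (opF_linearP n w)) -(Qp_fl K _ i j) opF_fl opprK -mulr2n -scaler_nat scalerA.
by rewrite mulVf ?scale1r // pnatr_eq0.
Qed.

Lemma psi_calG n i j w : psi (calG K n i j) w = s *: opM n (Qp K (n *+ 2 + 1) i j) w.
Proof.
rewrite /psi /= GE (linD (psi_ext_linearl s w)) psi_ext_gen_fl Qp_fl !opM_psi -mulr2n.
by rewrite -scaler_nat scalerA; congr (_ *: _); field.
Qed.

Lemma generating_spec_psi : generating_spec s psi.
Proof.
split=> [x a b w|n i j|n i j|n i j]; first exact: psi_linear.
- apply: lfsum_ext (lfsumZ (s ^+ 2) (lfsum_opH n (Qp K (n *+ 2) i j))) => [k w|w].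
    rewrite /famH /XX scalerA Qp_horner double_half.
    by rewrite (_ : - (- k%:~R + n%:~R) = - (n - k)%:~R) // intrB addrC.
  by rewrite psi_calD.
- apply: lfsum_ext (lfsum_opF n (Qp K (n *+ 2) i j)) => [k w|w].
    rewrite /famF /XtXt Qp_horner double_half.
    rewrite (_ : - (- Defs.half K k + n%:~R) = - Defs.half K (n - 1 - k)) //.
    by rewrite /Defs.half !intrB; field.
  by rewrite psi_calDbar.
apply: lfsum_ext (lfsumZ s (lfsum_opM n (Qp K (n *+ 2 + 1) i j))) => [k w|w].
  rewrite /famM /XtX phimode.unlock hmode.unlock scalerA Qp_horner double_half1.
  rewrite (_ : - (- k%:~R + Defs.half K n) = - Defs.half K (n - k)) //.
  by rewrite /Defs.half !intrB; field.
by rewrite psi_calG.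
Qed.

(** The specification determines psi on the spanning coefficients [sym_gen]. *)
Lemma generating_spec_unique (psi1 psi2 : SDNSplus K -> {linear W -> W}) :
  generating_spec s psi1 -> generating_spec s psi2 ->
  forall a w, psi1 a w = psi2 a w.
Proof.
move=> [lin1 D1 Db1 G1] [lin2 D2 Db2 G2] a w.
have f1 : linear (fun a => psi1 a w) by move=> z b b'; apply: lin1.
have f2 : linear (fun a => psi2 a w) by move=> z b b'; apply: lin2.
rewrite (SDNSplus_span a) (linZ f1) (linZ f2) (linear_sumZ _ _ _ f1) (linear_sumZ _ _ _ f2).
congr (_ *: _); apply: eq_bigr => k _; congr (_ *: _).
case: k => [[e l] [[] []]]; rewrite /sym_gen (linZ f1) (linZ f2); congr (_ *: _).
- exact: lfsum_unique (Db1 _ _ _) (Db2 _ _ _) _.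
- exact: lfsum_unique (G1 _ _ _) (G2 _ _ _) _.
- exact: lfsum_unique (G1 _ _ _) (G2 _ _ _) _.
- exact: lfsum_unique (D1 _ _ _) (D2 _ _ _) _.
Qed.

Lemma projective_rep_psi : projective_rep psi.
Proof.
split=> [x a b w|p q a w|p q a b pa qb]; first exact: psi_linear.
  exact: Whomog_psi_ext.
have [c ec] := defect_scalar s2 (valP a) (valP b) (in_SDNSplus_sbr a b) pa qb.
exists c => w; rewrite -[psi (sbrp a b) w]/(psi_ext s (sbr (SDNSval a) (SDNSval b)) w).
by rewrite -ec /defect [RHS]addrC subrK.
Qed.

End Main.

Theorem theorem3p3 (R : realType) :
  exists Psi : SDNSplus R[i] -> {linear W R[i] -> W R[i]},
    [/\ generating_spec 'i%C Psi,
        forall Psi' : SDNSplus R[i] -> {linear W R[i] -> W R[i]},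
          generating_spec 'i%C Psi' -> forall a w, Psi' a w = Psi a w
      & projective_rep Psi].
Proof.
have i2 : ('i%C : R[i]) ^+ 2 = -1 by exact: sqr_i.
exists (psi 'i%C); split; first exact: generating_spec_psi.
  by move=> Psi' spec; apply: generating_spec_unique spec (generating_spec_psi _).
exact: projective_rep_psi.
Qed.
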